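(* Let $q\ge 3$ be an integer. There are no integers $\lambda\neq 0$ and $d\ge 1$ such that $\overline{\mathcal{F}(q+1,q,1;\lambda,d+1)}$ contains some GK foliation.
   Context: Foliations. $R_{4}$ is the radial vector field on $\mathbb{C}^{4}$, $i_Z$ is contraction by $Z$, and $\mathrm{Sing}$ of a form is its zero set. A two-dimensional holomorphic foliation of degree $e$ on $\mathbb{P}^3$ (complex projective space) is given by an integrable $1$-form $\Omega$ on $\mathbb{C}^{4}$ ($\Omega\wedge d\Omega=0$), with homogeneous polynomial coefficients of degree $e+1$, with $i_{R_4}\Omega=0$ and $\mathrm{codim}\,\mathrm{Sing}(\Omega)\ge 2$; $\Omega$ is taken up to multiplication by a nonzero scalar. The set of these foliations is $\mathscr{F}_2(e,3)$, a Zariski open subset of a projective variety. An affine chart is the composition of $(x_1,x_2,x_3)\mapsto(x_1:x_2:x_3:1)$ with an automorphism of $\mathbb{P}^3$. The families. For relatively prime positive integers $p>q>r$ (i.e. $\gcd(p,q,r)=1$), let $S=p x_1\,\partial/\partial x_1+q x_2\,\partial/\partial x_2+r x_3\,\partial/\partial x_3$ on $\mathbb{C}^3$ and $\nu_3=dx_1\wedge dx_2\wedge dx_3$. For $\lambda\in\mathbb{Z}$, $\mathcal{F}(p,q,r;\lambda,d+1)$ is the set of $\mathcal{F}\in\mathscr{F}_2(d+1,3)$ that in some affine chart are defined by $\omega=i_Si_X\nu_3$ for some polynomial vector field $X$ on $\mathbb{C}^3$ with $[S,X]=\lambda X$. The bar denotes Zariski closure in $\mathscr{F}_2(d+1,3)$.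 GK. Let $\omega$ be a germ at $x\in\mathbb{C}^3$ of integrable $1$-form with $x\in\mathrm{Sing}(\omega)$. With the convention $\mathrm{codim}(\emptyset)=4$, $x$ is a generalized Kupka (GK) singularity of $\omega$ if (as germs at $x$) $\mathrm{codim}(\mathrm{Sing}(d\omega))\ge 3$. For a foliation this refers to the forms defining it on affine charts (restrictions of $\Omega$). A foliation is GK if all its singularities are GK. *)

(* Defs.v *)
From HB Require Import structures.
From mathcomp Require Import all_boot all_order all_algebra.
From mathcomp Require Import classical_sets.
From mathcomp Require Import mpoly.

Set Implicit Arguments.
Unset Strict Implicit.
Unset Printing Implicit Defensive.

Import GRing.Theory.
Local Open Scope classical_set_scope.
Local Open Scope ring_scope.

(* Everything is set up over a field K; the intended one is the field of      *)
(* complex numbers.                                                           *)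

Definition zclosed (K : fieldType) (n : nat) (F : set ('I_n -> K)) : Prop :=
  exists E : set {mpoly K[n]},
    F = [set x | forall f : {mpoly K[n]}, E f -> f.@[x] = 0].

Definition rel_zclosed (K : fieldType) (n : nat) (V Z : set ('I_n -> K)) :
  Prop := exists2 F, zclosed F & Z = V `&` F.

Definition zirreducible (K : fieldType) (n : nat) (Z : set ('I_n -> K)) :
  Prop :=
  Z !=set0 /\ (forall A B, zclosed A -> zclosed B ->
                 Z `<=` A `|` B -> Z `<=` A \/ Z `<=` B).

(* A chain Z_0 < ... < Z_m of irreducible closed subsets of the subspace V.   *)
Definition irr_chain (K : fieldType) (n : nat) (V : set ('I_n -> K)) (m : nat)
    (Z : nat -> set ('I_n -> K)) : Prop :=
  (forall i, (i <= m)%N -> rel_zclosed V (Z i) /\ zirreducible (Z i)) /\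
  (forall i, (i < m)%N -> Z i `<` Z i.+1).

(* codim V >= k, where codim V = n - dim V and dim V is the Krull dimension   *)
(* of V for the Zariski topology. The empty set has no chain, hence the       *)
(* largest codimension: for k <= n + 1 this is the convention                 *)
(* codim set0 = n + 1.                                                        *)
Definition codim_ge (K : fieldType) (n : nat) (V : set ('I_n -> K)) (k : nat) :
  Prop := forall m Z, irr_chain V m Z -> (m + k <= n)%N.

(* The germ of V at x has codimension >= k.                                   *)
Definition germ_codim_ge (K : fieldType) (n : nat) (x : 'I_n -> K)
    (V : set ('I_n -> K)) (k : nat) : Prop :=
  exists U : set ('I_n -> K),
    [/\ zclosed (~` U), U x & codim_ge (V `&` U) k].

(* Polynomial vector fields and forms on K^n. A k-form eta is given by its    *)
(* values on the coordinate fields: eta i j = eta(d/dx_i, d/dx_j), etc.       *)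
Definition vfield (K : fieldType) (n : nat) := 'I_n -> {mpoly K[n]}.
Definition form1 (K : fieldType) (n : nat) := 'I_n -> {mpoly K[n]}.
Definition form2 (K : fieldType) (n : nat) := 'I_n -> 'I_n -> {mpoly K[n]}.
Definition form3 (K : fieldType) (n : nat) :=
  'I_n -> 'I_n -> 'I_n -> {mpoly K[n]}.

Definition contr1 (K : fieldType) (n : nat) (Z : vfield K n) (w : form1 K n) :
  {mpoly K[n]} := \sum_i Z i * w i.
Definition contr2 (K : fieldType) (n : nat) (Z : vfield K n) (w : form2 K n) :
  form1 K n := fun j => \sum_i Z i * w i j.
Definition contr3 (K : fieldType) (n : nat) (Z : vfield K n) (w : form3 K n) :
  form2 K n := fun j k => \sum_i Z i * w i j k.

Definition dform1 (K : fieldType) (n : nat) (w : form1 K n) : form2 K n :=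
  fun i j => mderiv i (w j) - mderiv j (w i).

Definition wedge12 (K : fieldType) (n : nat) (w : form1 K n) (eta : form2 K n) :
  form3 K n :=
  fun i j k => w i * eta j k - w j * eta i k + w k * eta i j.

Definition integrable1 (K : fieldType) (n : nat) (w : form1 K n) : Prop :=
  forall i j k, wedge12 w (dform1 w) i j k = 0.

Definition Sing1 (K : fieldType) (n : nat) (w : form1 K n) : set ('I_n -> K) :=
  [set x | forall i, (w i).@[x] = 0].
Definition Sing2 (K : fieldType) (n : nat) (w : form2 K n) : set ('I_n -> K) :=
  [set x | forall i j, (w i j).@[x] = 0].

Definition pullback1 (K : fieldType) (m n : nat)
    (phi : n.-tuple {mpoly K[m]}) (w : form1 K n) : form1 K m :=
  fun j => \sum_i (w i \mPo phi) * mderiv j (tnth phi i).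

(* nu_3 = dx_1 /\ dx_2 /\ dx_3, i.e. nu_3(e_i, e_j, e_k) is the determinant   *)
(* of the matrix with rows e_i, e_j, e_k.                                     *)
Definition nu3 (K : fieldType) : form3 K 3 :=
  fun i j k =>
    \det (\matrix_(a < 3, b < 3) (tnth [tuple i; j; k] a == b)%:R).

Definition radial (K : fieldType) (n : nat) : vfield K n := fun i => 'X_i.

Definition bracket (K : fieldType) (n : nat) (Y X : vfield K n) : vfield K n :=
  fun i => \sum_j (Y j * mderiv j (X i) - X j * mderiv j (Y i)).

(* Foliations of degree e on P^3 are represented by their defining            *)
(* homogeneous forms on K^4. Two forms represent the same foliation iff they  *)
(* differ by a nonzero scalar, and every predicate on foliations below is     *)
(* invariant under such scalars.                                              *)
Definition foliation (K : fieldType) (e : nat) (Omega : form1 K 4) : Prop :=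
  [/\ forall i, Omega i \is e.+1.-homog,
      integrable1 Omega,
      contr1 (@radial K 4) Omega = 0 &
      codim_ge (Sing1 Omega) 2].

(* The affine chart x |-> g (x_1, x_2, x_3, 1)^T, lifted to K^4.              *)
Definition chart (K : fieldType) (g : 'M[K]_4) : 4.-tuple {mpoly K[3]} :=
  [tuple \sum_(j < 4) g i j *: (if unlift ord_max j is Some k then 'X_k else 1)
  | i < 4].

Definition diagS (K : fieldType) (p q r : nat) : vfield K 3 :=
  fun i => (tnth [tuple p; q; r] i)%:R *: 'X_i.

(* The family F(p, q, r; lam, e). *)
Definition fol_family (K : fieldType) (p q r : nat) (lam : int) (e : nat) :
  set (form1 K 4) :=
  [set Omega | foliation e Omega /\
     exists (g : 'M[K]_4) (X : vfield K 3) (c : K),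
       [/\ g \in unitmx, c != 0,
           forall i, bracket (diagS K p q r) X i = lam%:~R *: X i &
           forall j, pullback1 (chart g) Omega j =
             c *: contr2 (diagS K p q r) (contr3 X (@nu3 K)) j]].

(* Homogeneous coordinates of Omega: its coefficients at the monomials of     *)
(* degree <= e + 1 (those of degree < e + 1 vanish for foliations of          *)
(* degree e).                                                                 *)
Definition coef_idx (e : nat) : finType := ('I_4 * 'X_{1..4 < e.+2})%type.
Definition form_coords (K : fieldType) (e : nat) (Omega : form1 K 4) :
  'I_#|coef_idx e| -> K :=
  fun k => (Omega (enum_val k).1)@_((enum_val k).2).

(* Zariski closure in the space of foliations of degree e, as a subspace of   *)
(* the projective space of forms; closed sets of the latter are cut out by    *)
(* homogeneous polynomials in the coordinates.                                *)
Definition fol_closure (K : fieldType) (e : nat) (A : set (form1 K 4)) :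
  set (form1 K 4) :=
  [set Omega | foliation e Omega /\
     forall (k : nat) (P : {mpoly K[#|coef_idx e|]}),
       P \is k.-homog ->
       (forall Omega', A Omega' -> P.@[form_coords Omega'] = 0) ->
       P.@[form_coords Omega] = 0].

Definition GK_sing (K : fieldType) (w : form1 K 3) (x : 'I_3 -> K) : Prop :=
  germ_codim_ge x (Sing2 (dform1 w)) 3.

Definition GK_foliation (K : fieldType) (Omega : form1 K 4) : Prop :=
  forall g : 'M[K]_4, g \in unitmx ->
  forall x : 'I_3 -> K, Sing1 (pullback1 (chart g) Omega) x ->
    GK_sing (pullback1 (chart g) Omega) x.

(* Main.v *)
(* In coordinates where S is diagonal with weights (q + 1, q, 1, 0), the form
   Omega of a member of the family is homogeneous and S-quasi-homogeneous, and
   is killed by S and by the radial field.  Comparing weights, d Omega vanishes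
   identically on one of the five coordinate lines (e0 e1), (e2 e3), (e1 e3),
   (e0 e2), (e0 e3) as soon as lam <> 0 and q >= 3.

   "d Omega vanishes on some line" is a closed condition.  A line is the image
   of a skew-symmetric 4 x 4 matrix p, and the condition says that the forms
   p |-> d Omega (p xi) have a common zero p <> 0; by the homogeneous
   Nullstellensatz this amounts to the vanishing of determinants that are
   homogeneous in the coefficients of Omega.  Pluecker's relation is not needed:
   a nonzero skew-symmetric p has rank at least 2, so its image contains a line.

   Finally, a line in Sing(d Omega) lies in Sing(Omega) by Euler's identity, and
   around each of its points Sing(d Omega) has codimension at most 2. *)
Require Import Defs.
From mathcomp Require Import all_boot all_order all_algebra.
From mathcomp Require Import complex.
From mathcomp Require Import classical_sets reals.
From mathcomp Require Import boolp perm mpoly zify ring.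

Set Implicit Arguments.
Unset Strict Implicit.
Unset Printing Implicit Defensive.

Import Order.TTheory GRing.Theory Num.Theory.
Local Open Scope ring_scope.

(** * The homogeneous Nullstellensatz *)

Lemma mnm1_lem (n : nat) (m : 'X_{1..n}) (i : 'I_n) : (0 < m i)%N -> (U_(i) <= m)%MM.
Proof. by move=> mi; apply/mnm_lepP => j; rewrite mnm1E; case: eqP => // <-. Qed.

Lemma mdeg_split (n N M : nat) (m : 'X_{1..n}) : mdeg m = (N + M)%N ->
  exists m1 m2 : 'X_{1..n}, [/\ m = (m1 + m2)%MM, mdeg m1 = N & mdeg m2 = M].
Proof.
elim: N M m => [|N IH] M m Hm.
  by exists 0%MM, m; rewrite add0m mdeg0.
have [i mi] : exists i, (0 < m i)%N.
  apply/existsP; apply: contra_eqT Hm => /existsPn m0.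
  rewrite mdegE big1 // => i _; apply/eqP; have := m0 i; by rewrite -eqn0Ngt.
have Dm : m = (U_(i) + (m - U_(i)))%MM by rewrite addmC submK ?mnm1_lem.
have [|m1 [m2 [E1 D1 D2]]] := IH M (m - U_(i))%MM.
  by move: Hm; rewrite {1}Dm mdegD mdeg1; lia.
exists (U_(i) + m1)%MM, m2; split => //; last by rewrite mdegD mdeg1 D1.
by rewrite {1}Dm E1 addmA.
Qed.

(** * Graded ideals and the existence of maximal relevant ones *)

Section GradedIdeal.
Context {K : fieldType} {n : nat}.
Local Notation S := {mpoly K[n]}.
Implicit Types (I : set (nat * S)) (f g h : S).

(* I (k, f) means that the form f of degree k lies in the homogeneous ideal I. *)
Definition gideal I : Prop :=
  [/\ forall k f, I (k, f) -> f \is k.-homog,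
      forall k, I (k, 0),
      forall k f g, I (k, f) -> I (k, g) -> I (k, f + g) &
      forall j k h f, h \is j.-homog -> I (k, f) -> I ((j + k)%N, h * f)].

(** Says that [I] contains no power of the irrelevant ideal, the condition under which a projective
    zero is expected. *)
Definition relevant I : Prop :=
  forall N, exists2 f, f \is N.-homog & ~ I (N, f).

Lemma gidealZ I : gideal I -> forall k c f, I (k, f) -> I (k, c *: f).
Proof.
move=> [_ _ _ IM] k c f If; rewrite -mul_mpolyC -(add0n k); apply: IM => //.
by rewrite -alg_mpolyC rpredZ ?dhomog1.
Qed.

Lemma gidealB I : gideal I ->
  forall k f g, I (k, f) -> I (k, g) -> I (k, f - g).
Proof.
move=> gI k f g If Ig; rewrite -scaleN1r; case: (gI) => _ _ ID _.
by apply: ID => //; apply: gidealZ.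
Qed.

Lemma gideal_sum I : gideal I -> forall k (T : eqType) (s : seq T) (F : T -> S),
  (forall x, x \in s -> I (k, F x)) -> I (k, \sum_(x <- s) F x).
Proof.
move=> [_ I0 ID _] k T s F HF; rewrite big_seq.
by elim/big_ind: _ => //= x y; exact: ID.
Qed.

Lemma gideal_monomials I : gideal I -> forall N,
  (forall m : 'X_{1..n}, mdeg m = N -> I (N, 'X_[m])) ->
  forall f, f \is N.-homog -> I (N, f).
Proof.
move=> gI N HN f hf; rewrite [f]mpolyE; apply: gideal_sum => // m mf.
by apply: gidealZ => //; apply: HN; exact: (dhomog_mf hf).
Qed.

(** The graded pieces of the ideal [I + (f)]. The alternative [h = 0] covers the degrees below [d],
    where no cofactor degree [j] exists. *)
Definition gadd I (d : nat) f : set (nat * S) :=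
  fun z => exists p h, [/\ I (z.1, p), z.2 = p + h * f &
    h = 0 \/ exists2 j, z.1 = (j + d)%N & h \is j.-homog].

Lemma gideal_gadd I d f : gideal I -> f \is d.-homog -> gideal (gadd I d f).
Proof.
move=> gI hf; case: (gI) => IH I0 ID IM; split.
- move=> k g [p [h [/= Ip -> Hh]]]; apply: rpredD; first exact: IH.
  case: Hh => [-> | [j -> hj]]; first by rewrite mul0r rpred0.
  exact: dhomogM.
- by move=> k; exists 0, 0; split; [exact: I0| rewrite mul0r addr0 | left].
- move=> k g1 g2 [p1 [h1 [/= Ip1 -> H1]]] [p2 [h2 [/= Ip2 -> H2]]].
  exists (p1 + p2), (h1 + h2); split; [exact: ID | by rewrite /=; ring |].
  case: H1 H2 => [-> | [j1 E1 hj1]]; first by rewrite add0r.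
  case=> [-> | [j2 E2 hj2]]; first by rewrite addr0; right; exists j1.
  right; exists j1 => //; apply: rpredD => //.
  suff -> : j1 = j2 by [].
  by move: E1; rewrite /= E2 => /addIn.
- move=> j k h g hj [p [h1 [/= Ip -> H1]]].
  exists (h * p), (h * h1); split; [exact: IM | by rewrite /=; ring |].
  case: H1 => [-> | [j1 E1 hj1]]; first by rewrite mulr0; left.
  by right; exists (j + j1)%N; [rewrite /= E1 addnA | exact: dhomogM].
Qed.

Lemma sub_gadd I d f : gideal I -> (I `<=` gadd I d f)%classic.
Proof.
by move=> gI [k g] Ig; exists g, 0; split => //; [rewrite mul0r addr0 | left].
Qed.

Lemma gadd_gen I d f : gideal I -> gadd I d f (d, f).
Proof.
move=> [_ I0 _ _]; exists 0, 1; split; [exact: I0 | by rewrite add0r mul1r |].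
by right; exists 0%N; [rewrite add0n | exact: dhomog1].
Qed.

Definition gmaximal I : Prop := [/\ gideal I, relevant I &
  forall J, gideal J -> (I `<=` J)%classic -> relevant J -> J = I].

(** Zorn's lemma: relevance passes to the union of a chain because each degree has only finitely
    many monomials. *)
Lemma gmaximal_exists I : gideal I -> relevant I ->
  exists2 J, (I `<=` J)%classic & gmaximal J.
Proof.
move=> gI rI.
(* Adjoining [I] takes care of the empty chain, whose union then stands for [I] itself. *)
pose Q (A : set (nat * S)) := gideal (A `|` I)%classic /\ relevant (A `|` I)%classic.
have [F FQ Ftot|A [[gA rA] Amax]] := @Zorn_bigcup _ Q; last first.
  exists (A `|` I)%classic; first exact: subsetUr.
  split => // J gJ IJ rJ; apply/seteqP; split => //.
  apply: contrapT => nJ.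
  have JI : (J `|` I = J)%classic.
    by apply/setUidPl; apply: subset_trans IJ; exact: subsetUr.
  apply: (Amax J); last by rewrite /Q JI.
  split; first by apply: subset_trans IJ; exact: subsetUl.
  by move=> JA; apply: nJ; apply: subset_trans (@subsetUl _ A I).
have inF (z : nat * S) : ((\bigcup_(X in F) X) `|` I)%classic z ->
    exists B, [/\ gideal B, relevant B, B z,
      (B `<=` (\bigcup_(X in F) X) `|` I)%classic &
      B = I \/ exists2 X, F X & (B = X `|` I)%classic].
  case=> [[X FX Xz]|Iz]; last by exists I; split => //; left.
  have [gX rX] := FQ _ FX.
  exists (X `|` I)%classic; split => //; [by left| |by right; exists X].
  by apply: setSU => u Xu; exists X.
have in2 (z w : nat * S) : ((\bigcup_(X in F) X) `|` I)%classic z ->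
    ((\bigcup_(X in F) X) `|` I)%classic w ->
    exists B, [/\ gideal B, relevant B, B z, B w &
      (B `<=` (\bigcup_(X in F) X) `|` I)%classic].
  move=> /inF [B [gB rB Bz sB HB]] /inF [C [gC rC Cw sC HC]].
  have [BC|CB] : (B `<=` C \/ C `<=` B)%classic; last 2 first.
  - by exists C; split => //; exact: BC.
  - by exists B; split => //; exact: CB.
  case: HB => [->|[X FX EX]].
    by left; case: HC => [->|[Y _ ->]] //; exact: subsetUr.
  case: HC => [->|[Y FY EY]]; first by right; rewrite EX; exact: subsetUr.
  by rewrite EX EY; have [XY|YX] := Ftot _ _ FX FY; [left|right]; exact: setSU.
split; first split.
- by move=> k f /inF [B [[H _ _ _] _ Bz _ _]]; exact: H.
- by move=> k; right; case: gI.
- move=> k f g Hf Hg; have [B [[_ _ H _] _ Bf Bg sB]] := in2 _ _ Hf Hg.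
  by apply: sB; exact: H.
- move=> j k h f hj /inF [B [[_ _ _ H] _ Bz sB _]].
  by apply: sB; exact: H.
move=> N.
apply: contrapT => HN.
have HN' f : f \is N.-homog -> ((\bigcup_(X in F) X) `|` I)%classic (N, f).
  by move=> hf; apply: contrapT => nf; apply: HN; exists f.
(* If the union contains all forms of degree [N], running through the monomials of degree [N] and
   passing to a larger member of the chain when necessary yields one member [B] that contains them
   all. This contradicts the relevance of [B]. *)
have [B [gB rB HB]] : exists B, [/\ gideal B, relevant B &
   forall m : 'X_{1..n < N.+1}, mdeg m = N -> B (N, 'X_[m])].
  suff [B [gB rB _ HB]] : exists B, [/\ gideal B, relevant B,
      B = I \/ exists2 X, F X & (B = X `|` I)%classic &
   forall m : 'X_{1..n < N.+1}, m \in enum {: 'X_{1..n < N.+1}} ->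
     mdeg m = N -> B (N, 'X_[m])].
    by exists B; split => // m; apply: HB; rewrite mem_enum.
  elim: (enum _) => [|m s [B [gB rB FB HB]]]; first by exists I; split => //; left.
  case: (boolP (mdeg m == N)) => [/eqP Em|Nm]; last first.
    exists B; split => // m' ; rewrite inE => /orP[/eqP -> E|]; last exact: HB.
    by rewrite E eqxx in Nm.
  have [|C [gC rC Cm _ FC]] := inF (N, 'X_[m]).
    by apply: HN'; rewrite dhomogX; apply/eqP.
  have [BC|CB] : (B `<=` C \/ C `<=` B)%classic; last 2 first.
  - exists C; split => // m'; rewrite inE => /orP[/eqP -> //|ms Em'].
    by apply: BC; exact: HB.
  - exists B; split => // m'; rewrite inE => /orP[/eqP -> _|]; last exact: HB.
    exact: CB.
  case: FB => [->|[X FX EX]].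
    by left; case: FC => [->|[Y _ ->]] //; exact: subsetUr.
  case: FC => [->|[Y FY EY]]; first by right; rewrite EX; exact: subsetUr.
  by rewrite EX EY; have [XY|YX] := Ftot _ _ FX FY; [left|right]; exact: setSU.
have [f hf nf] := rB N; apply: nf; apply: gideal_monomials => // m Em.
have lt : (mdeg m < N.+1)%N by rewrite Em.
exact: (HB (BMultinom lt)).
Qed.

End GradedIdeal.

Lemma linear_dependence (K : fieldType) (B : finType) (r : nat) (w : 'I_r -> B -> K) :
  (#|B| < r)%N ->
  exists2 v : 'I_r -> K, exists t, v t != 0 & forall b, \sum_t v t * w t b = 0.
Proof.
move=> ltBr; pose W := \matrix_(t < r, b < #|B|) w t (enum_val b).
have /rowV0Pn[v] : kermx W != 0.
  rewrite kermx_eq0 /row_free; apply: contraTN ltBr => /eqP <-.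
  by rewrite -leqNgt rank_leq_col.
move=> /sub_kermxP vW vn0; exists (v 0).
  have [t vt] := rV0Pn _ vn0; by exists t.
move=> b; have := congr1 (fun A : 'rV_#|B| => A 0 (enum_rank b)) vW.
rewrite !mxE => E; rewrite -[RHS]E; apply: eq_bigr => t _.
by rewrite mxE enum_rankK.
Qed.

(** * Linear forms modulo a maximal relevant ideal *)

Section MaximalIdeal.
Context {K : closedFieldType} {n : nat}.
Local Notation S := {mpoly K[n]}.
Context (I : set (nat * S)) (maxI : gmaximal I).
Implicit Types (f g h : S).

Let gI : gideal I. Proof. by case: maxI. Qed.

Lemma gmaximal_add d f : f \is d.-homog -> ~ I (d, f) ->
  exists N, forall M g, (N <= M)%N -> g \is M.-homog -> gadd I d f (M, g).
Proof.
move=> hf nf; have gJ := gideal_gadd gI hf.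
have [N HN] : exists N, forall g, g \is N.-homog -> gadd I d f (N, g).
  apply: contrapT => H; apply: nf.
  have [_ _ maxJ] := maxI.
  rewrite -(maxJ _ gJ (sub_gadd _ _ gI)); first exact: gadd_gen.
  move=> N; apply: contrapT => H'; apply: H; exists N => g hg.
  by apply: contrapT => ng; apply: H'; exists g.
exists N => M g NM; move: g; apply: gideal_monomials => // m Em.
have [|m1 [m2 [-> E1 E2]]] := @mdeg_split n (M - N)%N N m; first by rewrite subnK.
rewrite mpolyXD -{1}(subnK NM); case: gJ => _ _ _ JM; apply: JM.
  by rewrite dhomogX; apply/eqP.
by apply: HN; rewrite dhomogX; apply/eqP.
Qed.

(** If neither factor lies in [I], then [I + (f)] and [I + (g)] fill some degrees [N] and [M]. The
    product of these two ideals lies in [I] as soon as [f * g] does, so [I] fills degree [N + M] and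
    is not relevant. *)
Lemma gmaximal_prime d e f g : f \is d.-homog -> g \is e.-homog ->
  I ((d + e)%N, f * g) -> I (d, f) \/ I (e, g).
Proof.
move=> hf hg Ifg; apply: contrapT => /not_orP[nf ng].
have [N HN] := gmaximal_add hf nf; have [M HM] := gmaximal_add hg ng.
have [_ rI _] := maxI; have [u hu] := rI (N + M)%N; apply.
move: u hu; apply: gideal_monomials => // m Em.
have [m1 [m2 [-> E1 E2]]] := mdeg_split Em; rewrite mpolyXD.
have h1 : ('X_[m1] : S) \is N.-homog by rewrite dhomogX; apply/eqP.
have h2 : ('X_[m2] : S) \is M.-homog by rewrite dhomogX; apply/eqP.
have [p [s [/= Ip Ep Hs]]] := HN _ _ (leqnn N) h1.
have [q [t [/= Iq Eq Ht]]] := HM _ _ (leqnn M) h2.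
have [IH I0 ID IM] := gI.
have -> : 'X_[m1] * 'X_[m2] = 'X_[m2] * p + (s * f * q + s * t * (f * g)) :> S.
  by rewrite Ep Eq; ring.
apply: (ID); first by rewrite addnC; exact: IM.
have hsf : s * f \is N.-homog.
  have -> : s * f = 'X_[m1] - p by rewrite Ep; ring.
  by apply: rpredB => //; exact: IH.
apply: (ID); first exact: IM.
case: Hs => [->|[j Ej hj]]; first by rewrite !mul0r.
case: Ht => [->|[k Ek hk]]; first by rewrite mulr0 mul0r.
have -> : (N + M = (j + k) + (d + e))%N by lia.
by apply: IM => //; exact: dhomogM.
Qed.

Lemma gmaximal_not1 : ~ I (0%N, 1).
Proof.
have [_ rI _] := maxI; have [f hf nf] := rI 0%N; move=> I1; apply: nf.
by rewrite -(mulr1 f) -(addn0 0%N); case: gI => _ _ _; apply.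
Qed.

Context (l : S) (hl : l \is 1.-homog) (nl : ~ I (1%N, l)).

Lemma gmaximal_expr k : ~ I (k, l ^+ k).
Proof.
elim: k => [|k IH]; first by rewrite expr0; exact: gmaximal_not1.
have hlk := dhomogMn k hl; rewrite mul1n in hlk.
by rewrite exprS -add1n => H; case: (gmaximal_prime hl hlk H).
Qed.

(** As [I + (l)] fills every degree from [N] on, a form of degree [N + j] can be divided by [l]
    modulo [I], one factor at a time, until degree [N] is reached. *)
Lemma gmaximal_reduce : exists N, forall j u, u \is (N + j).-homog ->
  exists2 w, w \is N.-homog & I ((N + j)%N, u - l ^+ j * w).
Proof.
have [N HN] := gmaximal_add hl nl; exists N; elim=> [|j IH] u hu.
  rewrite addn0 in hu; exists u => //; rewrite expr0 mul1r subrr.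
  by case: gI.
have [p [h [/= Ip -> [->|[k Ek hk]]]]] := HN _ _ (leq_addr j.+1 N) hu.
  by exists 0; rewrite ?rpred0 // mul0r mulr0 addr0 subr0.
have Ek' : k = (N + j)%N by lia.
rewrite Ek' in hk; have [w hw Iw] := IH _ hk; exists w => //.
have -> : p + h * l - l ^+ j.+1 * w = p + l * (h - l ^+ j * w).
  by rewrite exprS; ring.
case: gI => _ _ ID IM; apply: ID => //.
have -> : (N + j.+1 = 1 + (N + j))%N by lia.
exact: IM.
Qed.

(* The binary form of degree M in x and l whose dehomogenization is q. *)
Definition binform (x : S) (M : nat) (q : {poly K}) : S :=
  \sum_(t < M.+1) q`_t *: (x ^+ t * l ^+ (M - t)).

Lemma binform_mulXsubC (x : S) M c (q : {poly K}) : (size q <= M.+1)%N ->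
  binform x M.+1 (('X - c%:P) * q) = (x - c *: l) * binform x M q.
Proof.
move=> sq; rewrite /binform.
under eq_bigr => t _ do rewrite mulrBl coefB coefXM coefCM scalerBl.
rewrite sumrB mulrBl; congr (_ - _).
  rewrite big_ord_recl /= scale0r add0r mulr_sumr; apply: eq_bigr => t _.
  by rewrite /bump /= add1n subSS -scalerAr exprS mulrA.
rewrite big_ord_recr /= nth_default // mulr0 scale0r addr0.
rewrite mulr_sumr; apply: eq_bigr => t _.
rewrite subSn -1?ltnS // exprS -scalerAr -scalerAl scalerA mulrC.
by congr (_ *: _); rewrite mulrCA.
Qed.

Lemma bimonomial_homog (x : S) t M : x \is 1.-homog -> (t <= M)%N ->
  x ^+ t * l ^+ (M - t) \is M.-homog.
Proof.
move=> hx tM; have := dhomogM (dhomogMn t hx) (dhomogMn (M - t) hl).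
by rewrite !mul1n subnKC.
Qed.

Lemma binform_homog (x : S) M q : x \is 1.-homog -> binform x M q \is M.-homog.
Proof.
move=> hx; apply: rpred_sum => t _; apply: rpredZ.
by apply: bimonomial_homog => //; rewrite -ltnS.
Qed.

(** Over a closed field each root [c] of [q] splits off a factor [x - c *: l]; by primality this
    factor or the remaining form lies in [I]. A constant [q] would leave a power of [l] in [I],
    contrary to [gmaximal_expr]. *)
Lemma gmaximal_binform (x : S) M (q : {poly K}) : x \is 1.-homog -> q != 0 ->
  (size q <= M.+1)%N -> I (M, binform x M q) ->
  exists c, I (1%N, x - c *: l).
Proof.
move=> hx; elim: M q => [|M IH] q qn0 sq Iq.
  case: (@gmaximal_expr 0); move: Iq; rewrite /binform big_ord1 !expr0 mulr1.
  move=> /(gidealZ gI (q`_0)^-1); rewrite scalerA mulVf ?scale1r //.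
  by move: qn0; rewrite {1}(size1_polyC sq) polyC_eq0.
have [sq1|] := leqP (size q) 1.
  case: (@gmaximal_expr M.+1); move: Iq; rewrite /binform big_ord_recl /=.
  rewrite big1 ?addr0; last first.
    by move=> t _; rewrite nth_default ?scale0r //; apply: leq_trans sq1 _.
  rewrite expr0 mul1r subn0 => /(gidealZ gI (q`_0)^-1); rewrite scalerA mulVf ?scale1r //.
  by move: qn0; rewrite {1}(size1_polyC sq1) polyC_eq0.
move=> sq1; have /closed_rootP[c /factor_theorem[r Er]] : size q != 1%N.
  by rewrite neq_ltn sq1 orbT.
have rn0 : r != 0 by apply: contraNneq qn0 => r0; rewrite Er r0 mul0r.
have sr : (size r <= M.+1)%N.
  by move: sq; rewrite Er size_Mmonic ?monicXsubC // size_XsubC addn2.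
move: Iq; rewrite Er mulrC binform_mulXsubC // -add1n => Iq.
case: (gmaximal_prime _ _ Iq).
- by apply: rpredB => //; exact: rpredZ.
- exact: binform_homog.
- by exists c.
exact: IH.
Qed.

(* Modulo I every form of large degree M is a multiple of [l ^+ (M - N)], so the
   graded pieces of S / I have bounded dimension and I contains a binary form in
   x and l; being prime, I contains one of its linear factors. *)
Lemma gmaximal_linear (x : S) : x \is 1.-homog -> exists c, I (1%N, x - c *: l).
Proof.
move=> hx; have [N HN] := gmaximal_reduce.
(* With this [M] there are [M + 1 > j] products [x ^+ t * l ^+ (M - t)], while their remainders
   [w t] have at most [j] coefficients; hence a linear relation between the remainders. *)
pose B := 'X_{1..n < N.+1}; pose j := #|{: B}|; pose M := (N + j)%N.
have hxl (t : 'I_M.+1) : x ^+ t * l ^+ (M - t) \is M.-homog.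
  by apply: bimonomial_homog => //; rewrite -ltnS.
have {}HN (t : 'I_M.+1) : exists w, w \is N.-homog /\
    I (M, x ^+ t * l ^+ (M - t) - l ^+ j * w).
  by have [w hw Iw] := HN _ _ (hxl t); exists w.
have [w Hw] := choice HN.
have [|v [t0 vt0] Hv] := @linear_dependence K B M.+1 (fun t m => (w t)@_m).
  by rewrite ltnS /M leq_addl.
have vw : \sum_t v t *: w t = 0.
  apply/mpolyP => m; rewrite mcoeff0 raddf_sum /=.
  have [mN|mN] := ltnP (mdeg m) N.+1.
    by rewrite -[RHS](Hv (BMultinom mN)); apply: eq_bigr => t _; rewrite mcoeffZ.
  rewrite big1 // => t _; rewrite mcoeffZ (dhomog_nemf_coeff (Hw t).1) ?mulr0 //.
  by apply: contraL mN => /eqP ->; rewrite -leqNgt.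
pose q := \poly_(t < M.+1) v (inord t).
have qv (t : 'I_M.+1) : q`_t = v t by rewrite coef_poly ltn_ord inord_val.
apply: (@gmaximal_binform x M q) => //.
- by apply: contraNneq vt0 => q0; rewrite -qv q0 coef0.
- exact: size_poly.
rewrite /binform.
have -> : \sum_(t < M.+1) q`_t *: (x ^+ t * l ^+ (M - t)) =
   \sum_(t < M.+1) v t *: (x ^+ t * l ^+ (M - t) - l ^+ j * w t).
  transitivity (\sum_(t < M.+1) q`_t *: (x ^+ t * l ^+ (M - t)) -
    l ^+ j * \sum_t v t *: w t); first by rewrite vw mulr0 subr0.
  by rewrite mulr_sumr -sumrB; apply: eq_bigr => t _; rewrite qv scalerBr -scalerAr.
apply: gideal_sum => // t _; apply: gidealZ => //; exact: (Hw t).2.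
Qed.

End MaximalIdeal.

(** For a variable ['X_i0] outside [I], each ['X_i] is congruent to [c i *: 'X_i0], so a form [f] of
    degree [k] is congruent to [f.@[c] *: 'X_i0 ^+ k]. If [f] is in [I] and [f.@[c]] is nonzero, a
    power of ['X_i0] falls into [I], which is impossible. *)
Lemma gmaximal_zero (K : closedFieldType) (n : nat) (I : set (nat * {mpoly K[n]})) :
  gmaximal I ->
  exists2 c : 'I_n -> K, exists i, c i != 0 & forall k f, I (k, f) -> f.@[c] = 0.
Proof.
move=> maxI; have [gI rI _] := maxI.
have hX (i : 'I_n) : ('X_i : {mpoly K[n]}) \is 1.-homog by rewrite dhomogX /= mdeg1.
have [i0 ni0] : exists i, ~ I (1%N, 'X_i).
  apply: contrapT => H; have [f hf] := rI 1%N; apply.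
  move: f hf; apply: gideal_monomials => // m /eqP/mdeg1P[i /eqP ->].
  by apply: contrapT => ni; apply: H; exists i.
have [c Hc] := choice (fun i => gmaximal_linear maxI (hX i0) ni0 (hX i)).
have nX k := gmaximal_expr maxI (hX i0) ni0 (k := k).
have Hm (m : 'X_{1..n}) :
    I (mdeg m, 'X_[m] - 'X_[m].@[c] *: 'X_i0 ^+ mdeg m).
  move Ek : (mdeg m) => k; elim: k m Ek => [|k IH] m Em.
    have -> : m = 0%MM by apply/eqP; rewrite -mdeg_eq0 Em.
    by rewrite mpolyX0 meval1 scale1r subrr; case: gI.
  have [m1 [m2 [Dm /eqP/mdeg1P[i /eqP E1] E2]]] := @mdeg_split n 1 k m Em.
  rewrite Dm E1 mpolyXD mevalM mevalXU.
  have -> : 'X_i * 'X_[m2] - (c i * 'X_[m2].@[c]) *: 'X_i0 ^+ k.+1 =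
     'X_i * ('X_[m2] - 'X_[m2].@[c] *: 'X_i0 ^+ k) +
     ('X_[m2].@[c] *: 'X_i0 ^+ k) * ('X_i - c i *: 'X_i0) :> {mpoly K[n]}.
    by rewrite -!mul_mpolyC mpolyCM exprS; ring.
  case: (gI) => _ _ ID IM; apply: ID.
    by rewrite -add1n; apply: IM; [exact: hX|exact: IH].
  rewrite -addn1; apply: IM => //; apply: rpredZ.
  by have := dhomogMn k (hX i0); rewrite mul1n.
have Hf k f : f \is k.-homog -> I (k, f - f.@[c] *: 'X_i0 ^+ k).
  move=> hf.
  have -> : f - f.@[c] *: 'X_i0 ^+ k =
      \sum_(m <- msupp f) f@_m *: ('X_[m] - 'X_[m].@[c] *: 'X_i0 ^+ k).
    rewrite (eq_bigr (fun m => f@_m *: 'X_[m] - (f@_m * 'X_[m].@[c]) *: 'X_i0 ^+ k)).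
      rewrite sumrB -mpolyE -scaler_suml; congr (_ - _ *: _).
      by rewrite mevalE; apply: eq_bigr => m _; rewrite mevalX.
    by move=> m _; rewrite scalerBr scalerA.
  apply: gideal_sum => // m mf; apply: gidealZ => //.
  by have := Hm m; rewrite (dhomog_mf hf mf).
have zero k f : I (k, f) -> f.@[c] = 0.
  move=> If; apply/eqP; apply: contrapT => /negP fc; apply: (nX k).
  have hf : f \is k.-homog by case: gI => H _ _ _; exact: H.
  have := gidealZ gI (f.@[c])^-1 (gidealB gI If (Hf k f hf)).
  by rewrite opprB addrC subrK scalerA mulVf // scale1r.
exists c => //; exists i0; apply: contra_notN (@nX 1%N) => /eqP c0.
by have := Hc i0; rewrite c0 scale0r subr0 expr1.
Qed.

(** The graded pieces of the ideal generated by forms of common degree [D]. The bound [D <= z.1] is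
    essential: below degree [D] the truncated difference [z.1 - D] would let constant cofactors
    through. *)
Definition ideal_of (K : fieldType) (n D : nat) (T : Type) (f : T -> {mpoly K[n]}) :
    set (nat * {mpoly K[n]}) :=
  fun z => exists s : seq ({mpoly K[n]} * T),
    z.2 = \sum_(x <- s) x.1 * f x.2 /\
    all (fun x => (D <= z.1)%N && (x.1 \is (z.1 - D).-homog)) s.

Lemma gideal_ideal_of (K : fieldType) (n D : nat) (T : Type) (f : T -> {mpoly K[n]}) :
  (forall t, f t \is D.-homog) -> gideal (ideal_of D f).
Proof.
move=> hf; split.
- move=> k _ [s [/= -> Hs]]; elim: s Hs => [|x s IH] /=; first by rewrite big_nil rpred0.
  case/andP=> /andP[Dk hx] Hs; rewrite big_cons; apply: rpredD; last exact: IH.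
  by rewrite -(subnK Dk); exact: dhomogM.
- by move=> k; exists [::]; rewrite big_nil.
- move=> k _ _ [s [/= -> Hs]] [t [/= -> Ht]]; exists (s ++ t).
  by rewrite big_cat all_cat /= Hs Ht.
- move=> j k h _ hh [s [/= -> Hs]]; exists [seq (h * x.1, x.2) | x <- s].
  rewrite big_map mulr_sumr; split; first by apply: eq_bigr => x _ /=; rewrite mulrA.
  rewrite all_map; apply: sub_all Hs => x /= /andP[Dk hx].
  by rewrite -addnBA // dhomogM // andbT; apply: leq_trans Dk _; rewrite leq_addl.
Qed.

(** Otherwise every degree has a monomial outside the ideal, which is then relevant; the zero of a
    maximal relevant ideal above it is a nontrivial common zero of the [f t]. *)
Lemma nullstellensatz (K : closedFieldType) (n D : nat) (T : Type)
    (f : T -> {mpoly K[n]}) : (forall t, f t \is D.-homog) ->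
  (forall c : 'I_n -> K, (forall t, (f t).@[c] = 0) -> forall i, c i = 0) ->
  exists N, forall m : 'X_{1..n}, mdeg m = N -> ideal_of D f (N, 'X_[m]).
Proof.
move=> hf nz; have gI := gideal_ideal_of hf; apply: contrapT => H.
have [|J IJ /gmaximal_zero[c [i ci] Hc]] := gmaximal_exists gI.
  move=> N; apply: contrapT => H'; apply: H; exists N => m Em.
  apply: contrapT => nm; apply: H'; exists 'X_[m] => //.
  by rewrite dhomogX; apply/eqP.
case/negP: ci; apply/eqP; apply: nz => t; apply: (Hc D); apply: IJ.
exists [:: (1, t)]; rewrite big_seq1 mul1r /= leqnn subnn /=.
by split => //; rewrite dhomog1.
Qed.

(** * Elimination *)

Definition deg_monomials (n N : nat) : {pred 'X_{1..n < N.+1}} :=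
  [pred m : 'X_{1..n < N.+1} | mdeg m == N].
Arguments deg_monomials : clear implicits.

Lemma dhomog_msize_le (K : fieldType) (n N : nat) (p : {mpoly K[n]}) :
  p \is N.-homog -> (msize p <= N.+1)%N.
Proof.
move=> hp; rewrite msizeE big_seq; elim/big_ind: _ => // [x y|m mp].
  by rewrite geq_max => -> ->.
by rewrite ltnS (dhomog_mf hp mp).
Qed.

Lemma meval_homog (K : fieldType) (n N : nat) (g : {mpoly K[n]}) (c : 'I_n -> K) :
  g \is N.-homog ->
  g.@[c] = \sum_(i < #|deg_monomials n N|)
    g@_(enum_val i) * ('X_[enum_val i] : {mpoly K[n]}).@[c].
Proof.
move=> hg; rewrite -(@big_enum_val _ _ _ _ (deg_monomials n N)
  (fun m : 'X_{1..n < N.+1} => g@_m * ('X_[m] : {mpoly K[n]}).@[c])) /=.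
have sg := dhomog_msize_le hg.
rewrite {1}(mpolywE sg) raddf_sum /= [RHS]big_mkcond; apply: eq_bigr => m _.
rewrite mevalZ unfold_in /=; case: ifP => // /negbT mN.
by rewrite (dhomog_nemf_coeff hg mN) mul0r.
Qed.

Lemma dhomog_prod1 (K : fieldType) (n b : nat) (f : 'I_b -> {mpoly K[n]}) :
  (forall i, f i \is 1.-homog) -> \prod_i f i \is b.-homog.
Proof.
elim: b f => [|b IH] f hf; first by rewrite big_ord0 dhomog1.
by rewrite big_ord_recl; apply: (@dhomogM _ _ _ 1 _ b) => //; apply: IH.
Qed.

Lemma dhomog_det (K : fieldType) (n b : nat) (M : 'M[{mpoly K[n]}]_b) :
  (forall i j, M i j \is 1.-homog) -> \det M \is b.-homog.
Proof.
move=> hM; apply: rpred_sum => s _; have hp := dhomog_prod1 (fun i => hM i (s i)).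
by case: (s : bool); rewrite ?expr1 ?expr0 ?mul1r ?mulN1r ?rpredN.
Qed.

(* If the forms [sum_k v_k F_t,k] have no nontrivial common zero, then every
   monomial m of some degree N is E_m(v), where E_m(a) is a combination of the
   [sum_k a_k F_t,k] that is linear in a; the determinant of the coefficients of
   the E_m(a) is a form in a that vanishes on A and equals 1 at v. *)
Lemma closure_common_zero (K : closedFieldType) (r n D : nat) (T : Type)
    (F : T -> 'I_r -> {mpoly K[n]}) (A : set ('I_r -> K)) (v : 'I_r -> K) :
  (forall t k, F t k \is D.-homog) ->
  (forall k (P : {mpoly K[r]}), P \is k.-homog ->
     (forall a, A a -> P.@[a] = 0) -> P.@[v] = 0) ->
  (forall a, A a -> exists2 c : 'I_n -> K, exists i, c i != 0 &
     forall t, (\sum_k a k *: F t k).@[c] = 0) ->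
  exists2 c : 'I_n -> K, exists i, c i != 0 &
     forall t, (\sum_k v k *: F t k).@[c] = 0.
Proof.
move=> hF Hv HA; apply: contrapT => H.
have [||N HN] := @nullstellensatz K n D T (fun t => \sum_k v k *: F t k).
- by move=> t; apply: rpred_sum => k _; apply: rpredZ; apply: hF.
- move=> c Hc i; apply/eqP; apply: contrapT => ci; apply: H.
  by exists c => //; exists i; apply/negP.
have {HN} HN (i : 'I_#|deg_monomials n N|) :
    ideal_of D (fun t => \sum_k v k *: F t k) (N, 'X_[enum_val i]).
  by apply: HN; apply/eqP; have := enum_valP i.
have {HN} [s Hs] := choice HN.
pose E i k : {mpoly K[n]} := \sum_(x <- s i) x.1 * F x.2 k.
have hE i k : E i k \is N.-homog.
  rewrite /E; case: (Hs i) => _; elim: (s i) => [|x u IH] /=; first by rewrite big_nil rpred0.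
  case/andP=> /andP[DN hx] /IH; rewrite big_cons; apply: rpredD.
  by rewrite -(subnK DN); apply: dhomogM.
have Ea a i : \sum_k a k *: E i k = \sum_(x <- s i) x.1 * \sum_k a k *: F x.2 k.
  under eq_bigr do rewrite scaler_sumr.
  rewrite exchange_big; apply: eq_bigr => x _; rewrite mulr_sumr.
  by apply: eq_bigr => k _; rewrite scalerAr.
pose M := \matrix_(i, j < #|deg_monomials n N|)
  \sum_k (E i k)@_(enum_val j) *: ('X_k : {mpoly K[r]}).
have Ma a : (\det M).@[a] =
    \det (\matrix_(i, j < #|deg_monomials n N|) (\sum_k a k *: E i k)@_(enum_val j)).
  rewrite -det_map_mx; congr (\det _); apply/matrixP => i j; rewrite !mxE.
  rewrite !raddf_sum /=; apply: eq_bigr => k _.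
  by rewrite mevalZ mevalXU mcoeffZ mulrC.
have : (\det M).@[v] = 0.
  apply: Hv.
    apply: dhomog_det => i j; rewrite mxE; apply: rpred_sum => k _.
    by apply: rpredZ; rewrite dhomogX /= mdeg1.
  move=> a /HA[c [i0 ci0] Hc]; apply/eqP; rewrite Ma -det_tr; apply/det0P.
  (* The values at [c] of all monomials of degree [N] form a kernel vector, since each [E_m(a)]
     vanishes at [c]. It is nonzero because its entry at the [N]-th power of ['X_i0] is
     [c i0 ^+ N]. *)
  exists (\row_(j < #|deg_monomials n N|) ('X_[enum_val j] : {mpoly K[n]}).@[c]).
    have m0N : mdeg (U_(i0) *+ N)%MM = N by rewrite mdegMn mdeg1 mul1n.
    have m0lt : (mdeg (U_(i0) *+ N)%MM < N.+1)%N by rewrite m0N.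
    have m0in : BMultinom m0lt \in deg_monomials n N by rewrite unfold_in /= m0N.
    apply/rV0Pn; exists (enum_rank_in m0in (BMultinom m0lt)).
    by rewrite mxE enum_rankK_in // -mpolyXn rmorphXn /= mevalXU expf_neq0.
  apply/rowP => i; rewrite !mxE.
  transitivity ((\sum_k a k *: E i k).@[c]).
    rewrite (@meval_homog _ _ N); last by apply: rpred_sum => k _; apply: rpredZ; apply: hE.
    by apply: eq_bigr => j _; rewrite !mxE mulrC.
  rewrite Ea raddf_sum /= big1 // => x _.
  by rewrite rmorphM /= Hc mulr0.
rewrite Ma; have -> : \matrix_(i, j < #|deg_monomials n N|)
    (\sum_k v k *: E i k)@_(enum_val j) = 1%:M.
  apply/matrixP => i j; rewrite !mxE Ea; case: (Hs i) => /= <- _.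
  rewrite mcoeffX; congr (_%:R); congr nat_of_bool.
  by rewrite (inj_eq val_inj) (inj_eq enum_val_inj).
by move/eqP; rewrite det1 oner_eq0.
Qed.

(** * Lines in the singular set *)

Lemma mpolyX_ind (K : fieldType) (n : nat) (P : {mpoly K[n]} -> Prop) :
  P 1 -> (forall i p, P p -> P ('X_i * p)) ->
  (forall c p, P p -> P (c *: p)) -> (forall p q, P p -> P q -> P (p + q)) ->
  forall p, P p.
Proof.
move=> P1 PX PZ PD p; rewrite [p]mpolyE.
elim/big_ind: _ => //; first by rewrite -(scale0r (1 : {mpoly K[n]})); exact: (PZ 0 1 P1).
move=> m _; apply: PZ; move Ek : (mdeg m) => k; elim: k m Ek => [|k IH] m Em.
  by have /eqP-> : m == 0%MM; rewrite -?mdeg_eq0 ?Em // mpolyX0.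
have [m1 [m2 [-> /eqP/mdeg1P[i /eqP ->] E2]]] := @mdeg_split n 1 k m Em.
by rewrite mpolyXD; apply: PX; exact: IH.
Qed.

Lemma mderivXU (K : fieldType) (n : nat) (i k : 'I_n) :
  ('X_k : {mpoly K[n]})^`M(i) = (k == i)%:R.
Proof.
rewrite mderivX mnm1E; case: eqP => [->|_]; last by rewrite scale0r.
have -> : (U_(i) - U_(i) = 0)%MM by apply/mnmP => l; rewrite mnmBE subnn mnm0E.
by rewrite scale1r mpolyX0.
Qed.

Lemma mderiv_comp (K : fieldType) (m n : nat) (phi : n.-tuple {mpoly K[m]})
    (j : 'I_m) (p : {mpoly K[n]}) :
  (p \mPo phi)^`M(j) = \sum_i (p^`M(i) \mPo phi) * (tnth phi i)^`M(j).
Proof.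
elim/mpolyX_ind: p => [|k p IH|c p IH|p q IHp IHq].
- rewrite comp_mpoly1 -mpolyC1 mderivC big1 // => i _.
  by rewrite mderivC comp_mpoly0 mul0r.
- rewrite rmorphM /= mderivM IH comp_mpolyXU -tnth_nth.
  under [RHS]eq_bigr do rewrite mderivM rmorphD !rmorphM /= mulrDl.
  rewrite big_split /=; congr (_ + _); last first.
    by rewrite mulr_sumr; apply: eq_bigr => i _; rewrite comp_mpolyXU -tnth_nth mulrA.
  rewrite (bigD1 k) //= big1 ?addr0 => [|i ik]; last first.
    by rewrite mderivXU eq_sym (negPf ik) comp_mpoly0 !mul0r.
  by rewrite mderivXU eqxx comp_mpoly1 mul1r mulrC.
- rewrite comp_mpolyZ mderivZ IH scaler_sumr; apply: eq_bigr => i _.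
  by rewrite mderivZ comp_mpolyZ scalerAl.
- rewrite comp_mpolyD mderivD IHp IHq -big_split; apply: eq_bigr => i _.
  by rewrite mderivD comp_mpolyD mulrDl.
Qed.

(** The exterior derivative commutes with pullback. The map being affine, its Jacobian [G] is
    constant and no second derivatives of [phi] occur. *)
Lemma dform1_pullback (K : fieldType) (m n : nat) (phi : n.-tuple {mpoly K[m]})
    (G : 'I_n -> 'I_m -> K) (w : form1 K n) (j k : 'I_m) :
  (forall i l, mderiv l (tnth phi i) = (G i l)%:MP) ->
  dform1 (pullback1 phi w) j k =
    \sum_i \sum_l (G i j * G l k) *: (dform1 w i l \mPo phi).
Proof.
move=> HG.
have D (a b : 'I_m) : mderiv a (pullback1 phi w b) =
    \sum_l \sum_i (G i a * G l b) *: ((w l)^`M(i) \mPo phi).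
  rewrite /pullback1 raddf_sum; apply: eq_bigr => l _ /=.
  rewrite HG mulrC mul_mpolyC mderivZ mderiv_comp scaler_sumr; apply: eq_bigr => i _.
  by rewrite HG mulrC mul_mpolyC scalerA mulrC.
rewrite /dform1 !D exchange_big /= -sumrB; apply: eq_bigr => i _.
rewrite -sumrB; apply: eq_bigr => l _.
by rewrite comp_mpolyB scalerBr [in X in _ - X]mulrC.
Qed.

Lemma euler_mpoly (K : fieldType) (n k : nat) (p : {mpoly K[n]}) :
  p \is k.-homog -> \sum_i 'X_i * p^`M(i) = k%:R *: p.
Proof.
move=> hp.
transitivity
  (\sum_(m <- msupp p) (mdeg m)%:R *: (p@_m *: 'X_[m] : {mpoly K[n]})); last first.
  rewrite [in RHS](mpolyE p) scaler_sumr big_seq [RHS]big_seq.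
  by apply: eq_bigr => m mp; rewrite (dhomog_mf hp mp).
rewrite [in LHS](mpolyE p).
under eq_bigr => i _ do rewrite raddf_sum mulr_sumr.
rewrite exchange_big; apply: eq_bigr => m _ /=.
rewrite mdegE natr_sum scaler_suml; apply: eq_bigr => i _.
rewrite mderivZ mderivX -!scalerAr scalerA mulrC -scalerA.
case: (posnP (m i)) => [->|mi]; first by rewrite !scale0r.
by rewrite -mpolyXD addmC submK ?mnm1_lem.
Qed.

(** Cartan's formula for the radial field: the Lie derivative multiplies [w] by [k + 1], and the
    term [d (i_R w)] vanishes. *)
Lemma contr_radial_dform1 (K : fieldType) (n k : nat) (w : form1 K n) (j : 'I_n) :
  (forall i, w i \is k.-homog) -> contr1 (@radial K n) w = 0 ->
  \sum_i 'X_i * dform1 w i j = k.+1%:R *: w j.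
Proof.
move=> hw Rw; rewrite /dform1.
under eq_bigr do rewrite mulrBr.
rewrite sumrB (euler_mpoly (hw j)).
suff -> : \sum_i 'X_i * (w i)^`M(j) = - w j.
  by rewrite opprK -natr1 scalerDl scale1r.
have := congr1 (mderiv j) Rw; rewrite mderiv0 /contr1 /radial raddf_sum /=.
under eq_bigr do rewrite mderivM.
rewrite big_split /= (bigD1 j) //= big1 => [|i ij].
  rewrite addr0 mderivXU eqxx mul1r => /eqP.
  by rewrite addrC addr_eq0 => /eqP.
by rewrite mderivXU (negPf ij) mul0r.
Qed.

Lemma Sing2_dform1 (K : numFieldType) (n k : nat) (w : form1 K n) (x : 'I_n -> K) :
  (forall i, w i \is k.-homog) -> contr1 (@radial K n) w = 0 ->
  Sing2 (dform1 w) x -> Sing1 w x.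
Proof.
move=> hw Rw Sx j; have := congr1 (meval x) (contr_radial_dform1 j hw Rw).
rewrite mevalZ raddf_sum /= big1 => [/esym/eqP|i _].
  by rewrite mulf_eq0 pnatr_eq0 => /eqP.
by rewrite mevalM Sx mulr0.
Qed.

(** * Affine charts and germs that contain a coordinate axis *)

Definition homc (K : fieldType) (x : 'I_3 -> K) (j : 'I_4) : K :=
  if unlift ord_max j is Some k then x k else 1.

Lemma meval_chart (K : fieldType) (g : 'M[K]_4) (x : 'I_3 -> K) (i : 'I_4) :
  (tnth (chart g) i).@[x] = \sum_j g i j * homc x j.
Proof.
rewrite tnth_mktuple raddf_sum; apply: eq_bigr => j _ /=; rewrite mevalZ /homc.
by case: (unlift _ _) => [k|]; rewrite ?mevalXU ?meval1.
Qed.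

Lemma mderiv_chart (K : fieldType) (g : 'M[K]_4) (i : 'I_4) (k : 'I_3) :
  mderiv k (tnth (chart g) i) = (g i (lift ord_max k))%:MP.
Proof.
rewrite tnth_mktuple raddf_sum (bigD1 (lift ord_max k)) //= big1 => [|j jk].
  rewrite addr0 mderivZ liftK mderivXU eqxx.
  by rewrite -mul_mpolyC mulr1.
rewrite mderivZ; case: unliftP jk => [l -> jk|-> _].
  rewrite mderivXU; case: (l =P k) jk => [->|_ _]; first by rewrite eqxx.
  by rewrite scaler0.
by rewrite -mpolyC1 mderivC scaler0.
Qed.

Lemma exists_unroot (K : numFieldType) (p : {poly K}) : p != 0 -> exists t, ~~ root p t.
Proof.
move=> pn0; apply: contrapT => H.
suff : (size [seq i%:R : K | i <- iota 0 (size p)] < size p)%N.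
  by rewrite size_map size_iota ltnn.
apply: max_poly_roots => //.
  by apply/allP => t _; apply: contrapT => /negP nt; apply: H; exists t.
by rewrite map_inj_uniq ?iota_uniq // => i j /eqP; rewrite eqr_nat => /eqP.
Qed.

Definition axis_pt (K : fieldType) (t : K) : 'I_3 -> K :=
  fun i => if i == ord0 then t else 0.

Definition axis_poly (K : fieldType) (f : {mpoly K[3]}) : {poly K} :=
  \sum_(m <- msupp f) (f@_m)%:P * \prod_i (if i == ord0 then 'X else 0) ^+ m i.

Lemma horner_axis_poly (K : fieldType) (f : {mpoly K[3]}) t :
  (axis_poly f).[t] = f.@[axis_pt t].
Proof.
rewrite mevalE horner_sum; apply: eq_bigr => m _.
rewrite hornerM hornerC horner_prod; congr (_ * _); apply: eq_bigr => i _.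
by rewrite horner_exp /axis_pt; case: ifP => _; rewrite ?hornerX ?horner0.
Qed.

Lemma axis_poly_neq0 (K : fieldType) (f : {mpoly K[3]}) t :
  f.@[axis_pt t] != 0 -> axis_poly f != 0.
Proof. by rewrite -horner_axis_poly; apply: contraNneq => ->; rewrite horner0. Qed.

(** With [L] the first axis, the origin and [V], [U], [L] intersected form a chain of length 1 in
    [V] intersected with [U], so the codimension is at most 2. Irreducibility is tested on
    restrictions to [L]: a product of nonzero univariate polynomials has a non-root. *)
Lemma germ_codim_axis (K : numFieldType) (V : set ('I_3 -> K)) :
  (forall t, V (axis_pt t)) -> ~ germ_codim_ge (axis_pt 0) V 3.
Proof.
move=> VL [U [[EU HU] U0 cU]].
have notU x : ~ U x <-> forall f, EU f -> f.@[x] = 0.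
  by rewrite -[~ U x]/((~` U)%classic x) HU.
(* One equation [u] of the complement of [U] is nonzero at the origin; from here on [U] is used only
   through its principal open subset where [u] does not vanish. *)
have [u Eu u0] : exists2 u, EU u & u.@[axis_pt 0] != 0.
  apply: contrapT => H; apply/(notU (axis_pt 0)) : U0 => f Ef.
  by apply/eqP; apply: contrapT => /negP f0; apply: H; exists f.
have inU x : u.@[x] != 0 -> U x.
  by move=> ux; apply: contrapT => /notU/(_ u Eu)/eqP; apply/negP.
pose L : set ('I_3 -> K) := [set x | exists t, x = axis_pt t]%classic.
pose Z (i : nat) :=
  if i is 0 then [set axis_pt (0 : K)]%classic else (V `&` U `&` L)%classic.
suff /cU : irr_chain (V `&` U)%classic 1 Z by [].
have ord3 (i : 'I_3) : [\/ i = ord0, i = inord 1 | i = inord 2].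
  case: i => [[|[|[|//]]] Hi]; [constructor 1|constructor 2|constructor 3];
  by apply/val_inj; rewrite /= ?inordK.
have in1 : inord 1 != ord0 :> 'I_3 by rewrite -val_eqE /= inordK.
have in2 : inord 2 != ord0 :> 'I_3 by rewrite -val_eqE /= inordK.
have Lclosed : zclosed L.
  exists ([set 'X_(inord 1)] `|` [set 'X_(inord 2)])%classic.
  apply/seteqP; split => [x [t ->] f [->|->]|x Hx].
  - by rewrite mevalXU /axis_pt (negPf in1).
  - by rewrite mevalXU /axis_pt (negPf in2).
  exists (x ord0); apply/funext => i; rewrite /axis_pt; case: (ord3 i) => ->.
  + by rewrite eqxx.
  + by rewrite (negPf in1) -(Hx 'X_(inord 1)) ?mevalXU //; left.
  + by rewrite (negPf in2) -(Hx 'X_(inord 2)) ?mevalXU //; right.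
have pt_closed : zclosed [set axis_pt (0 : K)]%classic.
  exists [set f | exists i, f = 'X_i]%classic.
  apply/seteqP; split => [x -> f [i ->]|x Hx].
    by rewrite mevalXU /axis_pt; case: ifP.
  apply/funext => i; have := Hx 'X_i (ex_intro _ i erefl).
  by rewrite mevalXU /axis_pt => ->; case: ifP.
have Z0 : (V `&` U `&` L)%classic (axis_pt 0) by split; [split|exists 0].
split; last first.
  case=> // _; split; first by move=> x ->.
  (* At a non-root [t], the factor ['X] keeps the point away from the origin and [axis_poly u] keeps
     it in [U]. *)
  have : 'X * axis_poly u != 0 by rewrite mulf_neq0 ?polyX_eq0 // (axis_poly_neq0 u0).
  move=> /exists_unroot[t]; rewrite rootM negb_or => /andP[].
  rewrite !rootE hornerX horner_axis_poly => t0 /inU Ut /(_ (axis_pt t)) H.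
  have /(congr1 (@^~ ord0)) : axis_pt t = axis_pt 0.
    by apply: H; split; [split|exists t].
  by rewrite /axis_pt eqxx => /eqP; apply/negP.
case=> [_|[_|//]].
  split.
    exists [set axis_pt (0 : K)]%classic => //.
    by apply/seteqP; split => [x ->|x [_ ->]] //; split => //; case: Z0.
  split; first by exists (axis_pt 0).
  move=> A B _ _ AB; have [A0|B0] := AB _ erefl; [left|right]; by move=> x ->.
split; first by exists L.
split; first by exists (axis_pt 0).
move=> A B [EA ->] [EB ->] AB; apply: contrapT => /not_orP[nA nB].
have sep (E : set {mpoly K[3]}) :
    ~ (V `&` U `&` L `<=` [set x | forall f, E f -> f.@[x] = 0])%classic ->
    exists2 f, E f & axis_poly f != 0.
  move=> nE; apply: contrapT => H; apply: nE => _ [_ [t ->]] f Ef.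
  apply/eqP; apply: contrapT => /negP ft; apply: H; exists f => //.
  exact: axis_poly_neq0 ft.
have [f Ef f0] := sep _ nA; have [h Eh h0] := sep _ nB.
have : axis_poly u * (axis_poly f * axis_poly h) != 0.
  by rewrite !mulf_neq0 // (axis_poly_neq0 u0).
move=> /exists_unroot[t]; rewrite !rootM !negb_or !rootE !horner_axis_poly.
move=> /and3P[/inU Ut ft ht].
have [|/(_ f Ef)|/(_ h Eh)] := AB (axis_pt t); first by split; [split|exists t].
  by apply/eqP.
by apply/eqP.
Qed.

(** The rank factorization of the matrix with rows [v], [u] extends to an invertible matrix having
    these as its first rows; a transposition and a transpose make them columns 0 and 3. In the chart
    of [g] the first axis is then parametrized by [u + t v]. *)
Lemma complete_basis (K : fieldType) (u v : 'rV[K]_4) : row_free (col_mx v u) ->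
  exists g : 'M[K]_4, [/\ g \in unitmx,
    forall i, g i ord0 = v 0 i & forall i, g i ord_max = u 0 i].
Proof.
move=> fA; pose A : 'M_(2, 4) := col_mx v u.
pose C : 'M[K]_(2 + 2, 4) := block_mx (col_ebase A) 0 0 1%:M *m row_ebase A.
have uC : C \in unitmx.
  rewrite unitmx_mul row_ebase_unit andbT unitmxE det_lblock det1 mulr1.
  by rewrite -unitmxE col_ebase_unit.
have EA : usubmx C = A.
  rewrite -[RHS]mulmx_ebase (eqP fA) /C /block_mx mul_col_mx col_mxKu.
  have <- : col_ebase A *m (row_mx 1%:M 0 : 'M_(2, 2 + 2)) = row_mx (col_ebase A) 0.
    by rewrite mul_mx_row mulmx1 mulmx0.
  by congr (_ *m _ *m _); exact: esym (pid_mx_row _ _ _).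
have rowC (k : 'I_2) i : C (lshift 2 k) i = A k i by rewrite -EA [RHS]mxE.
exists (\matrix_(i, j) C (tperm (lshift 2 (ord_max : 'I_2)) ord_max j) i).
split.
- have -> : (\matrix_(i, j) C (tperm (lshift 2 (ord_max : 'I_2)) ord_max j) i) =
     (row_perm (tperm (lshift 2 (ord_max : 'I_2)) ord_max) C)^T.
    by apply/matrixP => i j; rewrite !mxE.
  by rewrite unitmx_tr row_permE unitmx_mul unitmx_perm.
- move=> i; rewrite mxE tpermD //.
  have -> : ord0 = lshift 2 (lshift 1 (ord0 : 'I_1)) by apply/val_inj.
  by rewrite rowC; exact: col_mxEu.
- move=> i; rewrite mxE tpermR rowC.
  have -> : ord_max = rshift 1 (ord0 : 'I_1) by apply/val_inj.
  exact: col_mxEd.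
Qed.

Lemma widen_ord_lift (n : nat) (i : 'I_n) : widen_ord (leqnSn n) i = lift ord_max i.
Proof. by apply/val_inj; rewrite /= /bump leqNgt ltn_ord. Qed.

(** In a chart where the line becomes the first axis, the origin is a singular point by
    [Sing2_dform1], and [germ_codim_axis] contradicts the GK condition there. *)
Lemma GK_no_line (K : numFieldType) (e : nat) (Omega : form1 K 4) (u v : 'rV[K]_4) :
  foliation e Omega -> row_free (col_mx v u) ->
  (forall s t, Sing2 (dform1 Omega) (fun i => s * u 0 i + t * v 0 i)) ->
  ~ GK_foliation Omega.
Proof.
move=> [hO _ RO _] /complete_basis[g [ug g0 g3]] Huv GK.
have hc t i : (tnth (chart g) i).@[axis_pt t] = 1 * u 0 i + t * v 0 i.
  rewrite meval_chart big_ord_recr /= /homc unlift_none mulr1 g3 mul1r addrC.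
  rewrite (bigD1 ord0) //= big1 => [|k k0].
    rewrite widen_ord_lift liftK /axis_pt eqxx addr0 mulrC -g0.
    by congr (_ + _ * g i _); apply/val_inj.
  by rewrite widen_ord_lift liftK /axis_pt (negPf k0) mulr0.
have Hx t : Sing2 (dform1 Omega) (fun i => (tnth (chart g) i).@[axis_pt t]).
  move=> i j; rewrite (@meval_eq _ _ _ (fun i => 1 * u 0 i + t * v 0 i)); last exact: hc.
  exact: Huv.
have S1 : Sing1 (pullback1 (chart g) Omega) (axis_pt 0).
  move=> j; rewrite /pullback1 raddf_sum big1 // => i _ /=.
  by rewrite mevalM comp_mpoly_meval (Sing2_dform1 hO RO (Hx 0)) mul0r.
apply: germ_codim_axis (GK g ug _ S1) => t i j.
rewrite (dform1_pullback _ _ _ (mderiv_chart g)) raddf_sum big1 // => a _ /=.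
rewrite raddf_sum big1 // => b _ /=.
by rewrite mevalZ comp_mpoly_meval Hx mulr0.
Qed.

(** * Quasi-homogeneous forms *)

(* The fourth weight is the default value 0 of [nth]. *)
Definition weights (q : nat) (i : nat) : nat := nth 0%N [:: q.+1; q; 1%N] i.

(* A monomial [x_a^x x_b^y dx_i dx_j] of [d Omega] has weight [lam + 2q + 2] and
   d Omega (e_a, e_b) = 0 on the line (e_a e_b), so d Omega vanishes on the line
   given here. *)
Lemma weights_gap (q d : nat) (lam : int) : (3 <= q)%N -> (1 <= d)%N -> lam != 0 ->
  exists a b : 'I_4, a != b /\ forall (i j : 'I_4) (x y : nat), i != j ->
    ~~ ((i \in [:: a; b]) && (j \in [:: a; b])) -> (x + y = d.+1)%N ->
    (weights q a * x + weights q b * y + weights q i + weights q j)%:Z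
      <> lam + (q.*2.+2)%:Z.
Proof.
move=> q3 d1 lam0.
pose o (k : nat) : 'I_4 := inord k.
have val_o k : (k < 4)%N -> o k = k :> nat by move=> k4; rewrite /o inordK.
have ord4 (P : 'I_4 -> Prop) :
    (forall k (Hk : (k < 4)%N), P (Ordinal Hk)) -> forall i, P i.
  by move=> HP [k Hk].
(* On the line of weights 1 and 0, the weight is at most [(d + 1) + (2q + 1)], which is too small
   when [lam > d]. *)
have [big|small] := ltP (d%:Z) lam.
  exists (o 2), (o 3); split; first by rewrite -val_eqE /= !val_o.
  elim/ord4 => [[|[|[|[|//]]]] Hi]; elim/ord4 => [[|[|[|[|//]]]] Hj] x y;
  rewrite !inE -!val_eqE /= !val_o //= => _ _; rewrite /weights /=; lia.
(* On the line of weights [q + 1] and [q], the weight is at least [q (d + 1) + 1], which is too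
   large when [lam < q d - q - 1]. *)
have [neg|pos] := ltP lam ((q * d)%:Z - q%:Z - 1).
  exists (o 0), (o 1); split; first by rewrite -val_eqE /= !val_o.
  elim/ord4 => [[|[|[|[|//]]]] Hi]; elim/ord4 => [[|[|[|[|//]]]] Hj] x y;
  rewrite !inE -!val_eqE /= !val_o //= => _ _ Exy; rewrite /weights /=;
  (have -> : (q.+1 * x + q * y = x + (q + q * d))%N
     by rewrite -mulnS -Exy mulnDr mulSn addnA); lia.
(* What remains is [q d - q - 1 <= lam <= d], hence [(q - 1) d <= q + 1]. As [lam] is nonzero, this
   leaves [d = 1] with [lam = 1] or [lam = -1], and [d = 2], [q = 3], [lam = 2]. *)
have [Ed|[Ed Eq]] : d = 1%N \/ d = 2%N /\ q = 3%N by nia.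
- have [El|El] : lam = 1 \/ lam = -1 by lia.
  + exists (o 1), (o 3); split; first by rewrite -val_eqE /= !val_o.
    elim/ord4 => [[|[|[|[|//]]]] Hi]; elim/ord4 => [[|[|[|[|//]]]] Hj] x y;
    rewrite !inE -!val_eqE /= !val_o //= => _ _; rewrite /weights /=; subst d lam;
    case: x => [|[|[|//]]]; lia.
  + exists (o 0), (o 2); split; first by rewrite -val_eqE /= !val_o.
    elim/ord4 => [[|[|[|[|//]]]] Hi]; elim/ord4 => [[|[|[|[|//]]]] Hj] x y;
    rewrite !inE -!val_eqE /= !val_o //= => _ _; rewrite /weights /=; subst d lam;
    case: x => [|[|[|//]]]; lia.
have El : lam = 2 by lia.
exists (o 0), (o 3); split; first by rewrite -val_eqE /= !val_o.
elim/ord4 => [[|[|[|[|//]]]] Hi]; elim/ord4 => [[|[|[|[|//]]]] Hj] x y;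
rewrite !inE -!val_eqE /= !val_o //= => _ _; rewrite /weights /=; subst d lam q;
case: x => [|[|[|[|//]]]]; lia.
Qed.

(** * Weighted homogeneous polynomials *)

Definition mnm_weight (n : nat) (s : 'I_n -> nat) (m : 'X_{1..n}) : nat :=
  (\sum_i s i * m i)%N.

Definition whomog (K : fieldType) (n : nat) (s : 'I_n -> nat) (w : int)
    (p : {mpoly K[n]}) : Prop :=
  forall m, p@_m != 0 -> (mnm_weight s m)%:Z = w.

Section WeightedHomogeneous.
Context {K : fieldType} {n : nat} (s : 'I_n -> nat).
Implicit Types (p : {mpoly K[n]}).

Lemma mnm_weightDU (m : 'X_{1..n}) i : mnm_weight s (m + U_(i)) = (mnm_weight s m + s i)%N.
Proof.
rewrite /mnm_weight; under eq_bigr do rewrite mnmDE mulnDr.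
rewrite big_split /=; congr (_ + _)%N.
rewrite (bigD1 i) //= mnm1E eqxx muln1 big1 ?addn0 // => j ji.
by rewrite mnm1E eq_sym (negPf ji) muln0.
Qed.

Lemma whomogZ w c p : whomog s w p -> whomog s w (c *: p).
Proof. by move=> Hp m; rewrite mcoeffZ mulf_eq0 negb_or => /andP[_ /Hp]. Qed.

Lemma whomog_sum w (T : Type) (r : seq T) (F : T -> {mpoly K[n]}) :
  (forall t, whomog s w (F t)) -> whomog s w (\sum_(t <- r) F t).
Proof.
move=> HF m; rewrite raddf_sum /= => nz; apply/eqP; apply: contraNT nz => Hw.
by rewrite big1 // => t _; apply/eqP; apply: contraNT Hw => /HF/eqP.
Qed.

Lemma mcoeff_XU_mul (i : 'I_n) p m : ('X_i * p)@_(m + U_(i)) = p@_m.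
Proof. by rewrite mulrC addmC mcoeffMX. Qed.

Lemma mcoeff_XU_mul0 (i : 'I_n) p (m : 'X_{1..n}) : m i = 0%N -> ('X_i * p)@_m = 0.
Proof.
move=> mi; apply/eqP; rewrite mcoeff_eq0 mulrC (perm_mem (msuppMX _ _)).
apply/mapP => -[m' _ Em]; move: mi.
by rewrite Em mnmDE mnm1E eqxx.
Qed.

Lemma whomogXU w i p : whomog s w p -> whomog s (w + (s i)%:Z) ('X_i * p).
Proof.
move=> Hp m nz; have mi : (0 < m i)%N.
  by rewrite lt0n; apply: contraNneq nz => /mcoeff_XU_mul0 ->.
have Em : m = (m - U_(i) + U_(i))%MM by rewrite submK ?mnm1_lem.
move: nz; rewrite Em mcoeff_XU_mul => /Hp <-.
by rewrite mnm_weightDU PoszD.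
Qed.

End WeightedHomogeneous.

(** * The weights of the forms [i_S i_X nu_3] *)

Section Family.
Context {K : numFieldType}.

Lemma nu3E (i j k : 'I_3) : @nu3 K i j k =
  (\det (\matrix_(a < 3, b < 3) (tnth [tuple i; j; k] a == b)%:R))%:MP.
Proof.
rewrite /nu3 -det_map_mx; congr (\det _); apply/matrixP => a b.
by rewrite !mxE rmorph_nat.
Qed.

Lemma nu3_swap (i j k : 'I_3) : @nu3 K i j k = - @nu3 K i k j.
Proof.
rewrite !nu3E -mpolyCN; congr (_%:MP); pose o1 : 'I_3 := lift ord0 ord0.
set M := (X in - \det X).
have -> : (\matrix_(a < 3, b < 3) (tnth [tuple i; j; k] a == b)%:R) =
    row_perm (tperm o1 ord_max) M :> 'M[K]_3.
  apply/matrixP => a b; rewrite !mxE; congr (_ == _)%:R.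
  case: a => [[|[|[|//]]] Ha].
  - by rewrite tpermD // -val_eqE.
  - by have -> : Ordinal Ha = o1; [apply/val_inj | rewrite tpermL].
  - by have -> : Ordinal Ha = ord_max; [apply/val_inj | rewrite tpermR].
by rewrite row_permE det_mulmx det_perm odd_tperm /= expr1 mulN1r.
Qed.

(** A nonzero determinant forces [i], [j], [k] to be distinct, so they enumerate all three
    indices. *)
Lemma nu3_perm (i j k : 'I_3) (s : 'I_3 -> nat) : @nu3 K i j k != 0 ->
  (s i + s j + s k = \sum_l s l)%N.
Proof.
rewrite nu3E => nz; have inj : injective (tnth [tuple i; j; k]).
  move=> a b Eab; apply/eqP; apply: contraNT nz => ab.
  rewrite (determinant_alternate ab) ?mpolyC0 // => c.
  by rewrite !mxE Eab.
rewrite (reindex (tnth [tuple i; j; k])) /=; last exact/onW_bij/injF_bij.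
by rewrite !big_ord_recr big_ord0.
Qed.

(** The field [S] multiplies a monomial by its weight, and the bracket subtracts the weight of the
    [i]-th coordinate; coefficients are then compared in characteristic 0. *)
Lemma bracket_weight (p q r : nat) (lam : int) (X : vfield K 3) (i : 'I_3) :
  bracket (diagS K p q r) X i = lam%:~R *: X i ->
  whomog (tnth [tuple p; q; r]) (lam + (tnth [tuple p; q; r] i)%:Z) (X i).
Proof.
set s := tnth _ => E m nz; apply/eqP; rewrite -subr_eq -(eqr_int K).
apply/eqP; apply: (mulIf nz).
have := congr1 (mcoeff m) E; rewrite mcoeffZ => <-.
rewrite /bracket sumrB mcoeffB intrB mulrBl -!pmulrn; congr (_ - _).
  rewrite /mnm_weight natr_sum mulr_suml raddf_sum; apply: eq_bigr => l _ /=.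
  rewrite /diagS -/s -scalerAl mcoeffZ natrM -mulrA; congr (_ * _).
  have [ml|ml] := posnP (m l); first by rewrite ml mul0r mcoeff_XU_mul0.
  have Em : m = (m - U_(l) + U_(l))%MM by rewrite submK ?mnm1_lem.
  rewrite {3}Em mcoeff_XU_mul mcoeff_deriv -Em mnmBE mnm1E eqxx subn1 prednK //.
  by rewrite mulr_natl.
rewrite (bigD1 i) //= big1 ?addr0 => [|l li].
  by rewrite /diagS mderivZ mderivXU eqxx -scalerAr mulr1 mcoeffZ.
have il : (i == l) = false by rewrite eq_sym (negPf li).
by rewrite /diagS mderivZ mderivXU il scaler0 mulr0.
Qed.

Definition iSX (p q r : nat) (X : vfield K 3) : form1 K 3 :=
  contr2 (diagS K p q r) (contr3 X (@nu3 K)).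

(** A nonzero summand [S_i X_l nu3 l i k] has weight [s_i + (lam + s_l)], and
    [s_i + s_l = p + q + r - s_k] by [nu3_perm]. *)
Lemma whomog_iSX (p q r : nat) (lam : int) (X : vfield K 3) (k : 'I_3) :
  (forall i, bracket (diagS K p q r) X i = lam%:~R *: X i) ->
  whomog (tnth [tuple p; q; r]) (lam + (p + q + r)%:Z - (tnth [tuple p; q; r] k)%:Z)
    (iSX p q r X k).
Proof.
move=> HX; rewrite /iSX /contr2 /contr3; apply: whomog_sum => i.
rewrite -scalerAl; apply: whomogZ; rewrite mulr_sumr; apply: whomog_sum => l.
have [->|nz] := eqVneq (@nu3 K l i k) 0.
  by rewrite !mulr0 => m; rewrite mcoeff0 eqxx.
have := nu3_perm (tnth [tuple p; q; r]) nz; rewrite !big_ord_recr big_ord0 /=.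
rewrite -[tnth _ (widen_ord _ (widen_ord _ _))]/p.
rewrite -[tnth _ (widen_ord _ _)]/q -[tnth _ ord_max]/r.
rewrite add0n => Es; rewrite mulrCA nu3E mulrC -mulrA mul_mpolyC -scalerAr.
apply: whomogZ.
have := whomogXU (i := i) (bracket_weight (HX l)).
set w1 := (X in whomog _ X _); set w2 := (X in _ -> whomog _ X _).
suff -> : w1 = w2 by [].
by rewrite /w1 /w2 -Es !PoszD; ring.
Qed.

(** Contracting twice with [S] gives 0: by antisymmetry of [nu3] in its last two arguments the sum
    is its own opposite. *)
Lemma diagS_iSX (p q r : nat) (X : vfield K 3) :
  \sum_k diagS K p q r k * iSX p q r X k = 0.
Proof.
set Q := LHS; suff QN : Q = - Q.
  apply/eqP; have : Q + Q == 0 by rewrite {2}QN subrr.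
  by rewrite -mulr2n -scaler_nat scaler_eq0 pnatr_eq0.
rewrite {1}/Q /iSX /contr2 /contr3.
under eq_bigr do rewrite mulr_sumr.
rewrite exchange_big /Q /= -sumrN; apply: eq_bigr => i _.
rewrite /iSX /contr2 mulr_sumr -sumrN; apply: eq_bigr => k _.
rewrite mulrCA /contr3 -mulrN -mulrN -sumrN; congr (_ * (_ * _)).
by apply: eq_bigr => l _; rewrite nu3_swap mulrN.
Qed.
End Family.

(** * Linear changes of coordinates and dehomogenization *)

Lemma comp_mpolyA (K : fieldType) (l m n : nat) (u : n.-tuple {mpoly K[m]})
    (v : m.-tuple {mpoly K[l]}) (p : {mpoly K[n]}) :
  (p \mPo u) \mPo v = p \mPo [tuple tnth u i \mPo v | i < n].
Proof.
elim/mpolyX_ind: p => [|i p IH|c p IH|p q IHp IHq].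
- by rewrite !comp_mpoly1.
- by rewrite !rmorphM /= IH !comp_mpolyXU -!tnth_nth tnth_mktuple.
- by rewrite !comp_mpolyZ IH.
- by rewrite !comp_mpolyD IHp IHq.
Qed.

Lemma dhomog_comp (K : fieldType) (m n k : nat) (u : n.-tuple {mpoly K[m]})
    (p : {mpoly K[n]}) :
  (forall i, tnth u i \is 1.-homog) -> p \is k.-homog -> p \mPo u \is k.-homog.
Proof.
move=> hu hp; rewrite comp_mpolyEX big_seq; apply: rpred_sum => mm /(dhomog_mf hp) <-.
rewrite comp_mpolyX; apply: rpredZ => /=; rewrite mdegE.
elim/big_ind2: _ => //; first exact: dhomog1.
  by move=> p1 k1 p2 k2; exact: dhomogM.
by move=> i _; have := dhomogMn (mm i) (hu i); rewrite mul1n.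
Qed.

Section Charts.
Context {K : fieldType}.

Definition linmap (g : 'M[K]_4) : 4.-tuple {mpoly K[4]} :=
  [tuple \sum_(j < 4) g i j *: 'X_j | i < 4].

Definition affine_chart : 4.-tuple {mpoly K[3]} :=
  [tuple if unlift ord_max j is Some k then 'X_k else 1 | j < 4].

Lemma mderiv_linmap g i j : mderiv j (tnth (linmap g) i) = (g i j)%:MP.
Proof.
rewrite tnth_mktuple raddf_sum (bigD1 j) //= big1 => [|l lj].
  by rewrite addr0 mderivZ mderivXU eqxx -mul_mpolyC mulr1.
by rewrite mderivZ mderivXU (negPf lj) scaler0.
Qed.

Lemma meval_linmap g (x : 'I_4 -> K) i :
  (tnth (linmap g) i).@[x] = \sum_j g i j * x j.
Proof.
rewrite tnth_mktuple raddf_sum; apply: eq_bigr => j _ /=.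
by rewrite mevalZ mevalXU.
Qed.

Lemma chart_linmap (g : 'M[K]_4) :
  [tuple tnth (linmap g) i \mPo affine_chart | i < 4] = chart g.
Proof.
apply/eq_from_tnth => l; rewrite !tnth_mktuple raddf_sum; apply: eq_bigr => j _ /=.
by rewrite comp_mpolyZ comp_mpolyXU -tnth_nth tnth_mktuple.
Qed.

(** A chart is the standard chart followed by a linear map. Pulling back by the standard chart
    substitutes 1 for the last variable and drops the last component. *)
Lemma pullback_chart (g : 'M[K]_4) (w : form1 K 4) (k : 'I_3) :
  pullback1 (chart g) w k = pullback1 (linmap g) w (lift ord_max k) \mPo affine_chart.
Proof.
rewrite /pullback1 raddf_sum; apply: eq_bigr => i _ /=.
rewrite [in LHS]mderiv_chart [in RHS]mderiv_linmap rmorphM /= comp_mpolyC.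
by rewrite (comp_mpolyA (linmap g) affine_chart (w i)) chart_linmap.
Qed.

Lemma dhomog_linmap (g : 'M[K]_4) (k : nat) (w : form1 K 4) :
  (forall i, w i \is k.-homog) -> forall j, pullback1 (linmap g) w j \is k.-homog.
Proof.
move=> hw j; apply: rpred_sum => i _; rewrite mderiv_linmap mulrC mul_mpolyC.
apply: rpredZ; apply: dhomog_comp => // l; rewrite tnth_mktuple.
by apply: rpred_sum => b _; apply: rpredZ; rewrite dhomogX /= mdeg1.
Qed.

Lemma contr_radial_linmap (g : 'M[K]_4) (w : form1 K 4) :
  contr1 (@radial K 4) w = 0 -> contr1 (@radial K 4) (pullback1 (linmap g) w) = 0.
Proof.
rewrite /contr1 /radial /pullback1 => Rw.
transitivity ((\sum_i 'X_i * w i) \mPo linmap g); last by rewrite Rw comp_mpoly0.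
under eq_bigr do rewrite mulr_sumr.
rewrite exchange_big raddf_sum; apply: eq_bigr => i _ /=.
under eq_bigr do rewrite mderiv_linmap.
rewrite rmorphM /= comp_mpolyXU -tnth_nth tnth_mktuple mulr_suml.
by apply: eq_bigr => j _; rewrite -mul_mpolyC mulrA mulrC mulrA.
Qed.

Definition dehomog_mnm (m : 'X_{1..4}) : 'X_{1..3} :=
  [multinom m (lift ord_max i) | i < 3].

Lemma mdeg_dehomog m : mdeg m = (mdeg (dehomog_mnm m) + m ord_max)%N.
Proof.
rewrite !mdegE big_ord_recr /=; congr (_ + _)%N.
by apply: eq_bigr => i _; rewrite mnmE widen_ord_lift.
Qed.

Lemma comp_affine_chartX m : ('X_[m] : {mpoly K[4]}) \mPo affine_chart = 'X_[dehomog_mnm m].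
Proof.
rewrite comp_mpolyX big_ord_recr /= [tnth _ ord_max]tnth_mktuple unlift_none expr1n mulr1.
rewrite [RHS]mpolyXE_id; apply: eq_bigr => i _.
by rewrite widen_ord_lift tnth_mktuple liftK mnmE.
Qed.

(** In a fixed degree the last exponent is determined by the other three, so dehomogenization merges
    no monomials and loses no coefficients. *)
Lemma mcoeff_affine_chart (k : nat) (p : {mpoly K[4]}) m : p \is k.-homog ->
  mdeg m = k -> (p \mPo affine_chart)@_(dehomog_mnm m) = p@_m.
Proof.
move=> hp Em; rewrite [in LHS]comp_mpolyEX [in RHS](mpolyE p) !raddf_sum /=.
rewrite big_seq [RHS]big_seq; apply: eq_bigr => m' m'p.
rewrite comp_affine_chartX !mcoeffZ !mcoeffX; congr (_ * (nat_of_bool _)%:R).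
apply/eqP/eqP => [E|-> //]; have := mdeg_dehomog m'; rewrite E (dhomog_mf hp m'p).
rewrite -{1}Em mdeg_dehomog => /addnI Emax; apply/mnmP => i.
have [j ->|-> //] := unliftP ord_max i.
by have := congr1 (fun m : 'X_{1..3} => m j) E; rewrite !mnmE.
Qed.

Lemma affine_chart_eq0 (k : nat) (p : {mpoly K[4]}) : p \is k.-homog ->
  p \mPo affine_chart = 0 -> p = 0.
Proof.
move=> hp p0; apply/mpolyP => m; rewrite mcoeff0.
have [Em|Em] := eqVneq (mdeg m) k; last exact: dhomog_nemf_coeff hp Em.
by rewrite -(mcoeff_affine_chart hp Em) p0 mcoeff0.
Qed.

Lemma whomog_affine_chart (k : nat) (s : 'I_4 -> nat) w (p : {mpoly K[4]}) :
  s ord_max = 0%N -> p \is k.-homog ->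
  whomog (s \o lift ord_max) w (p \mPo affine_chart) -> whomog s w p.
Proof.
move=> s0 hp Hp m nz.
have Em : mdeg m = k by apply/eqP; apply: contraNT nz => /(dhomog_nemf_coeff hp)/eqP.
rewrite -(Hp (dehomog_mnm m)) ?(mcoeff_affine_chart hp Em) //; congr Posz.
rewrite /mnm_weight big_ord_recr /= s0 mul0n addn0.
by apply: eq_bigr => i _; rewrite mnmE widen_ord_lift.
Qed.

End Charts.

(** * Forms adapted to the diagonal field *)

Section Adapted.
Context {K : numFieldType}.

(** The two sums are the contractions with the radial field and with the diagonal field of weights
    [s]. Giving [dx_j] the weight [s j], the whole form has weight [mu]; the difference is taken in
    the integers since it may be negative. *)
Definition adapted (e : nat) (s : 'I_4 -> nat) (mu : int) (w : form1 K 4) : Prop :=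
  [/\ forall j, w j \is e.+1.-homog, \sum_j 'X_j * w j = 0,
      \sum_j (s j)%:R *: ('X_j * w j) = 0 &
      forall j, whomog s (mu - (s j)%:Z) (w j)].

Lemma tnth_weights q (k : 'I_3) :
  tnth [tuple q.+1; q; 1%N] k = weights q (lift ord_max k).
Proof. by case: k => [[|[|[|//]]] Hk]. Qed.

(** After the linear change [g], the first three coefficients dehomogenize to multiples of those of
    [iSX]. The diagonal field has last weight 0, so its contraction can be checked in the chart;
    [2q + 2] is the sum of the weights. *)
Lemma adapted_family (q : nat) (lam : int) (e : nat) (Omega : form1 K 4) :
  fol_family q.+1 q 1 lam e Omega ->
  exists2 g : 'M[K]_4, g \in unitmx &
    adapted e (weights q) (lam + (q.*2.+2)%:Z) (pullback1 (linmap g) Omega).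
Proof.
case=> -[hO _ RO _] [g [X [c [ug _ HX HO]]]]; exists g => //.
set W := pullback1 (linmap g) Omega; set mu := lam + _.
have hW j : W j \is e.+1.-homog by exact: dhomog_linmap.
have RW : \sum_j 'X_j * W j = 0 by exact: (contr_radial_linmap g RO).
have hXW j : 'X_j * W j \is (1 + e.+1).-homog.
  by apply: dhomogM => //; rewrite dhomogX /= mdeg1.
have EW k : W (lift ord_max k) \mPo affine_chart = c *: iSX q.+1 q 1 X k.
  by rewrite -pullback_chart HO.
have whW k : whomog (weights q) (mu - (weights q (lift ord_max k))%:Z) (W (lift ord_max k)).
  apply: (@whomog_affine_chart _ e.+1) => //; rewrite EW; apply: whomogZ.
  rewrite (_ : _ \o lift ord_max = tnth [tuple q.+1; q; 1%N]); last first.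
    by apply/funext => i /=; rewrite tnth_weights.
  have := whomog_iSX (k := k) HX; rewrite -tnth_weights.
  by have -> : (q.+1 + q + 1)%N = q.*2.+2 by lia.
split => //.
- apply: (@affine_chart_eq0 _ (1 + e.+1)).
    by apply: rpred_sum => j _; apply: rpredZ; exact: hXW.
  transitivity (c *: \sum_k diagS K q.+1 q 1 k * iSX q.+1 q 1 X k); last first.
    by rewrite diagS_iSX scaler0.
  rewrite big_ord_recr /= scale0r addr0 raddf_sum scaler_sumr; apply: eq_bigr => k _ /=.
  rewrite widen_ord_lift comp_mpolyZ rmorphM /= EW comp_mpolyXU -tnth_nth tnth_mktuple liftK.
  rewrite /diagS tnth_weights -scalerAl -scalerAr !scalerA mulrC.
  by rewrite -[nat_of_ord k]/(nat_of_ord (widen_ord (leqnSn 3) k)) widen_ord_lift.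
move=> j; have [k ->|->] := unliftP ord_max j; first exact: whW.
(* The last coefficient is not seen in the chart; its weight is read off from the radial relation,
   which expresses ['X_ord_max * W ord_max] through the other three products. *)
move=> m nz; rewrite subr0.
have : whomog (weights q) mu ('X_ord_max * W ord_max).
  have -> : 'X_ord_max * W ord_max = (-1) *: \sum_k 'X_(lift ord_max k) * W (lift ord_max k).
    have := RW; rewrite big_ord_recr /= addrC => /eqP; rewrite addr_eq0 => /eqP ->.
    by rewrite scaleN1r; congr (- _); apply: eq_bigr => k _; rewrite widen_ord_lift.
  apply: whomogZ; apply: whomog_sum => k.
  rewrite -[mu](subrK (weights q (lift ord_max k))%:Z).
  exact: whomogXU.
move=> /(_ (m + U_(ord_max))%MM); rewrite mcoeff_XU_mul => /(_ nz).
by rewrite (mnm_weightDU (fun i : 'I_4 => weights q i)) addn0.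
Qed.

(** On the line [(e_a e_b)] the two contractions become linear equations in [x_a w_a] and [x_b w_b]
    with determinant [s b - s a], so both products vanish. *)
Lemma adapted_coeff0 (e : nat) (s : 'I_4 -> nat) (mu : int) (w : form1 K 4) (a b : 'I_4)
    (m : 'X_{1..4}) : adapted e s mu w -> a != b -> s a != s b ->
  (forall i, i \notin [:: a; b] -> m i = 0%N) -> (w a)@_m = 0.
Proof.
move=> [_ R1 R2 _] ab sab m0.
have E (t : 'I_4 -> K) : \sum_j t j *: ('X_j * w j) = 0 ->
    t a * (w a)@_m + t b * ('X_b * w b)@_(m + U_(a)) = 0.
  move=> /(congr1 (mcoeff (m + U_(a)))); rewrite mcoeff0 raddf_sum /=.
  rewrite (bigD1 a) //= (bigD1 b) 1?eq_sym //= big1 ?addr0 => [|i /andP[ia ib]].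
    by rewrite !mcoeffZ mcoeff_XU_mul.
  rewrite mcoeffZ mcoeff_XU_mul0 ?mulr0 // mnmDE mnm1E eq_sym (negPf ia) addn0.
  by apply: m0; rewrite !inE negb_or ia ib.
have /E : \sum_j (fun=> 1) j *: ('X_j * w j) = 0.
  by rewrite -[RHS]R1; apply: eq_bigr => j _; rewrite scale1r.
rewrite !mul1r addrC => /eqP; rewrite addr_eq0 => /eqP yb.
have := E (fun j => (s j)%:R) R2; rewrite yb mulrN -mulrBl => /eqP.
by rewrite mulf_eq0 subr_eq0 eqr_nat (negPf sab) => /eqP.
Qed.

(** Only monomials in [x_a], [x_b] matter on the line. In the component of [dx_a dx_b] their
    coefficients vanish by [adapted_coeff0]; in every other component a nonzero one would have the
    total weight excluded by the gap hypothesis. *)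
Lemma adapted_line (e : nat) (s : 'I_4 -> nat) (mu : int) (w : form1 K 4) (a b : 'I_4)
    (x : 'I_4 -> K) : adapted e s mu w -> a != b -> injective s ->
  (forall (i j : 'I_4) (k l : nat), i != j ->
    ~~ ((i \in [:: a; b]) && (j \in [:: a; b])) -> (k + l = e)%N ->
    (s a * k + s b * l + s i + s j)%:Z <> mu) ->
  (forall i, i \notin [:: a; b] -> x i = 0) -> Sing2 (dform1 w) x.
Proof.
move=> Hw ab injs gap x0 i j.
have [->|ij] := eqVneq i j; first by rewrite /dform1 subrr meval0.
rewrite mevalE big1_seq // => m /andP[_]; rewrite mcoeff_msupp => nz.
have [m0|] := boolP [forall l, (l \notin [:: a; b]) ==> (m l == 0%N)]; last first.
  move=> /forallPn[l]; rewrite negb_imply => /andP[lab ml].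
  rewrite (bigD1 l) //= x0 // expr0n (negPf ml) mul0r mulr0 //.
have {}m0 l : l \notin [:: a; b] -> m l = 0%N.
  by move=> lab; apply/eqP; exact: (implyP (forallP m0 l)).
case/negP: nz; apply/eqP; rewrite /dform1 mcoeffB !mcoeff_deriv.
have sup t l : t \in [:: a; b] -> l \notin [:: a; b] -> (m + U_(t))%MM l = 0%N.
  move=> tab lab; rewrite mnmDE m0 // mnm1E; case: eqP => // tl.
  by rewrite -tl tab in lab.
have [/andP[iab jab]|nab] := boolP ((i \in [:: a; b]) && (j \in [:: a; b])).
  have w0 t u : t \in [:: a; b] -> u \in [:: a; b] -> (w t)@_(m + U_(u)) = 0.
    move=> tab uab; have sab : s a != s b by apply: contraNneq ab => /injs ->.
    move: tab; rewrite !inE => /orP[] /eqP ->.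
      by apply: (adapted_coeff0 Hw ab sab) => l; exact: sup.
    apply: (@adapted_coeff0 _ _ _ _ b a _ Hw); rewrite 1?eq_sym // => l lba.
    by apply: sup => //; move: lba; rewrite !inE orbC.
  by rewrite !w0 // !mul0rn subr0.
have wE : mnm_weight s m = (s a * m a + s b * m b)%N.
  rewrite /mnm_weight (bigD1 a) //= (bigD1 b) 1?eq_sym //= big1 ?addn0 // => l /andP[la lb].
  by rewrite m0 ?muln0 // !inE negb_or la lb.
have dE : mdeg m = (m a + m b)%N.
  rewrite mdegE (bigD1 a) //= (bigD1 b) 1?eq_sym //= big1 ?addn0 // => l /andP[la lb].
  by rewrite m0 // !inE negb_or la lb.
case: Hw => hw _ _ ww.
have w0 t u : t != u -> ~~ ((t \in [:: a; b]) && (u \in [:: a; b])) ->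
    (w t)@_(m + U_(u)) = 0.
  move=> tu tuab; apply/eqP; apply: contraT => nz.
  have Ed : mdeg (m + U_(u))%MM = e.+1.
    by apply/eqP; apply: contraNT nz => /(dhomog_nemf_coeff (hw t)) /eqP.
  have {}Ed : mdeg m = e by move: Ed; rewrite mdegD mdeg1 addn1 => -[].
  have := ww t _ nz; rewrite mnm_weightDU wE => Ew.
  case: (gap t u (m a) (m b) tu tuab); first by rewrite -dE.
  by rewrite addnAC PoszD Ew subrK.
by rewrite !w0 // ?mul0rn ?subr0 1?eq_sym // andbC.
Qed.

(** At [x] the pulled-back 2-form has matrix [g^T *m M *m g], where [M] is the matrix of [dform1 w]
    at the image point; [g] can be cancelled on both sides. *)
Lemma Sing2_linmap (g : 'M[K]_4) (w : form1 K 4) (x : 'I_4 -> K) : g \in unitmx ->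
  Sing2 (dform1 (pullback1 (linmap g) w)) x ->
  Sing2 (dform1 w) (fun i => \sum_j g i j * x j).
Proof.
move=> ug Sx; pose y i := \sum_j g i j * x j.
pose M := \matrix_(i, j) (dform1 w i j).@[y].
have : g^T *m M *m g = 0.
  apply/matrixP => j k; rewrite [RHS]mxE -[RHS](Sx j k).
  rewrite (dform1_pullback _ _ _ (mderiv_linmap g)) raddf_sum mxE /=.
  under [RHS]eq_bigr do rewrite raddf_sum.
  rewrite exchange_big /=; apply: eq_bigr => l _.
  rewrite mxE mulr_suml; apply: eq_bigr => i _ /=.
  rewrite mevalZ comp_mpoly_meval !mxE mulrAC; congr (_ * _).
  by apply: meval_eq => t; rewrite meval_linmap.
move=> /(congr1 (mulmxr (invmx g))); rewrite /= mulmxK // mul0mx.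
move=> /(congr1 (mulmx (invmx g^T))); rewrite mulKmx ?unitmx_tr // mulmx0.
by move=> M0 i j; have := congr1 (fun A : 'M_4 => A i j) M0; rewrite !mxE.
Qed.

End Adapted.

(** * The closure of the family *)

Lemma dhomog_mderiv (K : numFieldType) (n k : nat) (i : 'I_n) (p : {mpoly K[n]}) :
  p \is k.+1.-homog -> p^`M(i) \is k.-homog.
Proof.
move=> hp; apply/dhomogP => m; rewrite mcoeff_msupp mcoeff_deriv => nz.
have : mdeg (m + U_(i))%MM = k.+1.
  apply/eqP; apply: contraNT nz => /(dhomog_nemf_coeff hp) ->.
  by rewrite mul0rn.
by rewrite mdegD mdeg1 addn1 => -[].
Qed.

Lemma dhomog_dform1 (K : numFieldType) (n k : nat) (w : form1 K n) i j :
  (forall l, w l \is k.+1.-homog) -> dform1 w i j \is k.-homog.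
Proof. by move=> hw; apply: rpredB; apply: dhomog_mderiv. Qed.

Lemma family_line (K : numFieldType) (q d : nat) (lam : int) (Omega : form1 K 4) :
  (3 <= q)%N -> (1 <= d)%N -> lam != 0 -> fol_family q.+1 q 1 lam d.+1 Omega ->
  exists u v : 'I_4 -> K, (exists i j, u i * v j != u j * v i) /\
    forall s t, Sing2 (dform1 Omega) (fun i => s * u i + t * v i).
Proof.
move=> q3 d1 lam0 /adapted_family[g ug Hg].
have [a [b [ab gap]]] := weights_gap q3 d1 lam0.
exists (fun i => g i a), (fun i => g i b); split; last first.
  move=> s t; pose x j : K := if j == a then s else if j == b then t else 0.
  rewrite (_ : (fun i => _) = (fun i => \sum_j g i j * x j)); last first.
    apply/funext => i; rewrite (bigD1 a) //= (bigD1 b) 1?eq_sym //=.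
    rewrite big1 => [|j /andP[ja jb]].
      by rewrite /x eqxx [b == a]eq_sym (negPf ab) eqxx addr0 mulrC [t * _]mulrC.
    by rewrite /x (negPf ja) (negPf jb) mulr0.
  apply: Sing2_linmap => //; apply: (adapted_line Hg ab) => //.
    move=> i j; rewrite /weights.
    case: i => [[|[|[|[|//]]]] Hi]; case: j => [[|[|[|[|//]]]] Hj] /= E;
    by [apply/val_inj | move: E q3; clear; lia].
  by move=> i; rewrite !inE negb_or /x => /andP[/negPf -> /negPf ->].
(* If all 2 by 2 minors of columns [a] and [b] vanish, [g] kills [g i b e_a - g i a e_b] for each
   [i]. Injectivity gives [g i a = 0], so [g] kills [e_a], a contradiction. *)
apply: contrapT => H.
have {}H i j : g i a * g j b = g j a * g i b.
  by apply/eqP; apply: contrapT => /negP nz; apply: H; exists i, j.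
have inj (y : 'cV[K]_4) : g *m y = 0 -> y = 0.
  by move=> gy; rewrite -[y](mulKmx ug) gy mulmx0.
have ga i : g i a = 0.
  have /(congr1 (fun y : 'cV_4 => y b 0)) :
      g i b *: delta_mx a 0 - g i a *: delta_mx b 0 = 0 :> 'cV[K]_4.
    apply: inj; rewrite mulmxBr -!scalemxAr -!colE; apply/matrixP => j k.
    by rewrite !mxE mulrC H mulrC subrr.
  rewrite !mxE !eqxx eq_sym (negPf ab) mulr0 mulr1 sub0r => /eqP.
  by rewrite oppr_eq0 => /eqP.
have /(congr1 (fun y : 'cV_4 => y a 0)) : delta_mx a 0 = 0 :> 'cV[K]_4.
  by apply: inj; rewrite -colE; apply/matrixP => j k; rewrite !mxE ga.
by rewrite !mxE !eqxx => /eqP; rewrite oner_eq0.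
Qed.

(** * Bivectors and coordinates on the space of forms *)

Section Lines.
Context {K : numFieldType}.

Definition pair4 : finType := {x : 'I_4 * 'I_4 | (x.1 < x.2)%N}.

Definition bivector_coord (i j : 'I_4) (u : pair4) : K :=
  (val u == (i, j))%:R - (val u == (j, i))%:R.

(* The bivector with Pluecker coordinates c, as a skew-symmetric matrix. *)
Definition bivector (c : 'I_#|pair4| -> K) (i j : 'I_4) : K :=
  \sum_k bivector_coord i j (enum_val k) * c k.

Lemma bivectorC c i j : bivector c j i = - bivector c i j.
Proof. by rewrite -sumrN; apply: eq_bigr => k _; rewrite -mulNr opprB. Qed.

Lemma bivectorE c (u : pair4) : bivector c (val u).1 (val u).2 = c (enum_rank u).
Proof.
rewrite /bivector (bigD1 (enum_rank u)) //= big1 => [|k ku].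
  rewrite enum_rankK /bivector_coord -surjective_pairing eqxx addr0.
  case: eqP => [E|_]; last by rewrite subr0 mul1r.
  by have := valP u; have /= -> := congr1 fst E; rewrite ltnn.
rewrite /bivector_coord -surjective_pairing.
have /negPf -> : val (enum_val k) != val u.
  by apply: contraNneq ku => /val_inj <-; rewrite enum_valK.
case: eqP => [E|_]; last by rewrite subr0 mul0r.
have := valP u; have := valP (enum_val k); rewrite E /= => lt /(ltn_trans lt).
by rewrite ltnn.
Qed.

Definition wedge2 (u v : 'I_4 -> K) (k : 'I_#|pair4|) : K :=
  let: (i, j) := val (enum_val k) in u i * v j - u j * v i.

Lemma bivector_wedge2 u v i j : bivector (wedge2 u v) i j = u i * v j - u j * v i.
Proof.
have lt_case (i' j' : 'I_4) : (i' < j')%N ->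
    bivector (wedge2 u v) i' j' = u i' * v j' - u j' * v i'.
  move=> lt; have := bivectorE (wedge2 u v) (exist _ (i', j') lt : pair4) => /= ->.
  by rewrite /wedge2 enum_rankK.
have [lt|gt|/val_inj ->] := ltngtP i j; first exact: lt_case.
  by rewrite bivectorC lt_case // opprB.
rewrite subrr /bivector big1 // => k _.
by rewrite /bivector_coord subrr mul0r.
Qed.

(** The vector [p xi], as linear forms in the coordinates of the bivector [p]. As [xi] varies it
    sweeps out the image of [p]. *)
Definition contr_bivector (xi : 'I_4 -> K) : 4.-tuple {mpoly K[#|pair4|]} :=
  [tuple \sum_k (\sum_j xi j * bivector_coord i j (enum_val k)) *: 'X_k | i < 4].

Lemma meval_contr_bivector xi c i :
  (tnth (contr_bivector xi) i).@[c] = \sum_j xi j * bivector c i j.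
Proof.
rewrite tnth_mktuple raddf_sum /= (eq_bigr _ (fun k _ => mevalZ _ _ _)) /=.
under eq_bigr do rewrite mevalXU mulr_suml.
rewrite exchange_big; apply: eq_bigr => j _; rewrite mulr_sumr.
by apply: eq_bigr => k _; rewrite mulrA.
Qed.

Lemma dhomog_contr_bivector xi i : tnth (contr_bivector xi) i \is 1.-homog.
Proof.
by rewrite tnth_mktuple; apply: rpred_sum => k _; apply: rpredZ; rewrite dhomogX /= mdeg1.
Qed.

(** The index type also lists monomials of degree below [e + 1]; these are given the zero form, so
    that all basis forms are homogeneous of one degree. *)
Definition basis_form (e : nat) (k : 'I_#|coef_idx e|) : form1 K 4 :=
  fun i => if (i == (enum_val k).1) && (mdeg (enum_val k).2 == e.+1)
           then 'X_[(enum_val k).2] else 0.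

Lemma dhomog_basis_form e k i : @basis_form e k i \is e.+1.-homog.
Proof.
rewrite /basis_form; case: ifP => [/andP[_ Em]|_]; last exact: rpred0.
by rewrite dhomogX.
Qed.

Lemma form_coordsE (e : nat) (w : form1 K 4) i : (forall j, w j \is e.+1.-homog) ->
  w i = \sum_k form_coords w k *: @basis_form e k i.
Proof.
move=> hw; rewrite /form_coords /basis_form.
rewrite -(@big_enum_val _ _ _ _ (coef_idx e) (fun x : coef_idx e => (w x.1)@_x.2 *:
  (if (i == x.1) && (mdeg x.2 == e.+1) then 'X_[x.2] else 0))) /=.
have sw := dhomog_msize_le (hw i).
rewrite (eq_bigl xpredT) // -(pair_bigA _ (fun a (m : 'X_{1..4 < e.+2}) => (w a)@_m *:
  (if (i == a) && (mdeg m == e.+1) then 'X_[m] else 0))) /=.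
rewrite (bigD1 i) //= [X in _ + X]big1 => [|j ji]; last first.
  by rewrite big1 // => m _; rewrite eq_sym (negPf ji) scaler0.
rewrite addr0 [LHS](mpolywE sw); apply: eq_bigr => m _; rewrite eqxx /=.
case: ifP => // /negbT nm.
by rewrite (dhomog_nemf_coeff (hw i) nm) !scale0r.
Qed.

End Lines.

(** The polynomials [F t k] evaluate the differentials of the basis forms at [p xi], so the
    coordinates of a form enter linearly and [closure_common_zero] yields a nonzero bivector for
    [Omega]. *)
Lemma closure_line (K : numClosedFieldType) (e : nat) (A : set (form1 K 4)) Omega :
  (forall w, A w -> foliation e w /\
     exists u v : 'I_4 -> K, (exists i j, u i * v j != u j * v i) /\
       forall s t, Sing2 (dform1 w) (fun i => s * u i + t * v i)) ->
  fol_closure e A Omega ->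
  exists2 uv : 'rV[K]_4 * 'rV[K]_4, row_free (col_mx uv.2 uv.1) &
    forall s t, Sing2 (dform1 Omega) (fun i => s * uv.1 0 i + t * uv.2 0 i).
Proof.
move=> HA [[hO _ _ _] HO].
pose F (t : ('I_4 -> K) * ('I_4 * 'I_4)) (k : 'I_#|coef_idx e|) :=
  dform1 (basis_form k) t.2.1 t.2.2 \mPo contr_bivector t.1.
have FE w t c : (forall i, w i \is e.+1.-homog) ->
    (\sum_k form_coords w k *: F t k).@[c] =
    (dform1 w t.2.1 t.2.2).@[fun i => \sum_j t.1 j * bivector c i j].
  move=> hw.
  rewrite -(@meval_eq _ _ (fun i => (tnth (contr_bivector t.1) i).@[c])); last first.
    by move=> i; rewrite meval_contr_bivector.
  rewrite -comp_mpoly_meval; congr (_.@[c]).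
  have -> : dform1 w t.2.1 t.2.2 =
      \sum_k form_coords w k *: dform1 (@basis_form _ e k) t.2.1 t.2.2.
    have D i j : mderiv i (w j) =
        \sum_k form_coords w k *: mderiv i (@basis_form _ e k j).
      rewrite {1}(form_coordsE j hw) raddf_sum; apply: eq_bigr => k _.
      by rewrite /= mderivZ.
    by rewrite /dform1 !D -sumrB; apply: eq_bigr => k _; rewrite scalerBr.
  by rewrite raddf_sum; apply: eq_bigr => k _; rewrite /= comp_mpolyZ.
have hF t k : F t k \is e.-homog.
  apply: dhomog_comp; first by move=> i; exact: dhomog_contr_bivector.
  by apply: dhomog_dform1 => l; exact: dhomog_basis_form.
have [||c [k ck] Hc] := @closure_common_zero K _ _ e _ F
    [set a | exists2 w, A w & a = form_coords w]%classic (form_coords Omega) hF.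
- by move=> k P hP HP; apply: (HO k P hP) => w Aw; apply: HP; exists w.
- move=> _ [w /HA[[hw _ _ _] [u [v [[i [j nz]] Huv]]]] ->].
  (* Its image is spanned by [u] and [v]: it sends [xi] to [a u - b v], where [a] and [b] are the
     pairings of [xi] with [v] and [u]. *)
  exists (wedge2 u v).
    apply: contrapT => H; case/negP: nz; rewrite -subr_eq0 -bivector_wedge2.
    rewrite /bivector big1 // => k _; suff -> : wedge2 u v k = 0 by rewrite mulr0.
    by apply/eqP; apply: contrapT => /negP nz; apply: H; exists k.
  move=> t; rewrite FE //; set a := \sum_j t.1 j * v j; set b := \sum_j t.1 j * u j.
  rewrite (@meval_eq _ _ _ (fun i => a * u i + (- b) * v i)); first exact: Huv.
  move=> l; rewrite mulNr /a /b !mulr_suml -sumrB; apply: eq_bigr => m _.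
  by rewrite bivector_wedge2; ring.
(* A nonzero coordinate of [c] is an entry [p i j]. Columns [i] and [j] of [p] are then independent,
   since [p i i = p j j = 0] and [p j i = - p i j]. *)
pose p := bivector c; pose i := (val (enum_val k)).1; pose j := (val (enum_val k)).2.
have pij : p i j != 0 by rewrite /p bivectorE enum_valK.
have pii l : p l l = 0.
  have : p l l *+ 2 == 0 by rewrite mulr2n {2}/p bivectorC subrr.
  by rewrite mulrn_eq0 => /eqP.
exists (\row_l p l j, \row_l p l i) => /=; last first.
  move=> s t a b; pose xi l : K := s * (l == j)%:R + t * (l == i)%:R.
  have := Hc (xi, (a, b)); rewrite FE //= => H; rewrite -[RHS]H; apply: meval_eq => l.
  rewrite /xi; under eq_bigr do rewrite mulrDl.
  rewrite big_split /= (bigD1 j) //= big1 => [|m mj]; last first.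
    by rewrite (negPf mj) mulr0 mul0r.
  rewrite (bigD1 i) //= big1 => [|m mi]; last first.
    by rewrite (negPf mi) mulr0 mul0r.
  by rewrite !eqxx !mulr1 !addr0 !mxE.
apply: inj_row_free => x Ex.
have E l : x 0 (lshift 1 0) * p l i + x 0 (rshift 1 0) * p l j = 0.
  have := congr1 (fun y : 'rV_4 => y 0 l) Ex; rewrite !mxE big_split_ord /= !big_ord1.
  by rewrite col_mxEu col_mxEd !mxE.
have x1 : x 0 (rshift 1 0) = 0.
  by have := E i; rewrite pii mulr0 add0r => /eqP; rewrite mulf_eq0 (negPf pij) orbF => /eqP.
have x0 : x 0 (lshift 1 0) = 0.
  have := E j; rewrite pii mulr0 addr0 /p bivectorC => /eqP.
  by rewrite mulf_eq0 oppr_eq0 (negPf pij) orbF => /eqP.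
by apply/rowP => l; rewrite mxE -[l]splitK; case: split => m /=; rewrite ord1.
Qed.

Theorem corollary4p9 (R : realType) (q : nat) (hq : (3 <= q)%N) :
  ~ exists (lam : int) (d : nat),
      [/\ lam != 0, (1 <= d)%N &
          exists Omega : form1 R[i] 4,
            fol_closure d.+1 (@fol_family R[i] q.+1 q 1 lam d.+1) Omega /\
            GK_foliation Omega].
Proof.
case=> lam [d [lam0 d1 [Omega [clO GK]]]].
have [|[u v] fuv Huv] := @closure_line R[i] d.+1 _ Omega _ clO.
  by move=> w Hw; split; [case: Hw | exact: (family_line hq d1 lam0 Hw)].
by case: (clO) => fO _; exact: (GK_no_line fO fuv Huv GK).
Qed.
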